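(* Let $k\ge2$ and $q_k^*=\frac{k-1}{k^2}\,k^{\frac{k-2}{k-1}}$. In the region $0\le q\le q_k^*$, for each $i$ there is a maximal integer $N(n,i)$ such that for any $j<N(n,i)$, $$\beta_{i,j}(J_{k,n})=\beta_{i,j}(J_{k,\infty}).$$ Furthermore, $N(n,i)$ is increasing in $n$, for fixed $i$.
   Context: $T_{k,n}$ is the complete $k$-ary rooted tree of depth $n$: every non-leaf node has exactly $k$ children and all leaves are at distance $n$ from the root. Let $K$ be a field and $S_{k,n}=K[x_e: e\in E(T_{k,n})]$ the standard graded polynomial ring with one variable per edge. The path ideal $I_{k,n}$ is generated by the monomials $\prod_{e\in P}x_e$, $P$ running over the edge sets of the root-to-leaf paths, and the cut ideal is its squarefree Alexander dual $J_{k,n}=\bigcap_P\langle x_e:e\in P\rangle$. Here $\beta_{i,j}(J_{k,n})$ denotes the graded Betti number $\dim_K\mathrm{Tor}_i^{S_{k,n}}(S_{k,n}/J_{k,n},K)_j$ of the quotient ring. The number $q\in[0,1]$ is the common failure probability of the edges; it is the value substituted for the variable $t$ in the generating functions $\sum_{i,j>0}\beta_{i,j}(J_{k,n})x^it^j$ of the Betti numbers. The asymptotic graded Betti numbers $\beta_{i,j}(J_{k,\infty})$ are the coefficients of $x^it^j$ in the limiting generating function $G_{k,\infty}(x,t)$, namely the formal power series of the form $x\,w(x,t)$ with $w(0,0)=0$ satisfying $$G_{k,\infty}=x^{-(k-1)}\bigl((1+tx)(1+G_{k,\infty})-1\bigr)^k .$$ *)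

(* Defs.v *)
From HB Require Import structures.
From mathcomp Require Import all_boot all_order all_algebra.
From mathcomp Require Import classical_sets reals.
From mathcomp Require exp.
From mathcomp Require Import mpoly.

Set Implicit Arguments.
Unset Strict Implicit.
Unset Printing Implicit Defensive.

Import GRing.Theory.
Local Open Scope ring_scope.

(** * The tree T_{k,n} and its cut ideal *)

(* A node at depth d is the word of length d over 'I_k of the child choices
   made from the root (the empty word).  An edge is identified with its lower
   endpoint, hence with a word of length m.+1 with m < n. *)
Definition edge (k n : nat) : finType := {m : 'I_n & m.+1.-tuple 'I_k}.

Definition leaf (k n : nat) : finType := n.-tuple 'I_k.

(* The edges of the root-to-leaf path are the nonempty prefixes of the leaf. *)
Definition path_edges (k n : nat) (l : leaf k n) : {set edge k n} :=
  [set e : edge k n | tval (tagged e) == take (tag e).+1 l].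

Section CutIdeal.
Variables (K : fieldType) (k n : nat).

Definition edge_ring : comNzRingType := {mpoly K[#|edge k n|]}.

Definition edge_var (e : edge k n) : edge_ring := 'X_(enum_rank e).

Definition path_prime (l : leaf k n) (p : edge_ring) : Prop :=
  exists c : edge k n -> edge_ring,
    p = \sum_(e in path_edges l) c e * edge_var e.

Definition cut_ideal (p : edge_ring) : Prop :=
  forall l : leaf k n, path_prime l p.

End CutIdeal.

(** * Graded Betti numbers *)

Section Betti.
Variables (K : fieldType) (d : nat).
Notation S := {mpoly K[d]}.

(* The data of  ... -> F_1 -> F_0 -> S/J  with F_i graded free of finite rank,
   with homogeneous generators a of degree gdeg a.  Row vectors are used, so
   that the a-th row of [diff i] is the image in F_i of the a-th generator of
   F_{i+1}; [aug] lifts to S the images in S/J of the generators of F_0. *)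
Record free_complex := FreeComplex {
  rk : nat -> nat;
  gdeg : forall i : nat, 'I_(rk i) -> nat;
  diff : forall i : nat, 'M[S]_(rk i.+1, rk i);
  aug : 'cV[S]_(rk 0)
}.

Definition graded_free_resolution (J : S -> Prop) (F : free_complex) : Prop :=
  [/\ (* the maps have degree 0 *)
      forall i (a : 'I_(rk F i.+1)) (b : 'I_(rk F i)),
        {in msupp (diff F i a b), forall u, mdeg u + gdeg b = gdeg a}%N,
      forall b : 'I_(rk F 0),
        {in msupp (aug F b 0), forall u, mdeg u = gdeg b},
      (* exactness at S/J, at F_0 and at F_{i+1} *)
      forall p : S, exists v : 'rV_(rk F 0), J (p - (v *m aug F) 0 0),
      forall v : 'rV_(rk F 0),
        J ((v *m aug F) 0 0) <-> exists u, v = u *m diff F 0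
    & forall i (v : 'rV_(rk F i.+1)),
        v *m diff F i = 0 <-> exists u, v = u *m diff F i.+1].

Section Tor.
Variable F : free_complex.

(* The differential of F (x)_S K, where K = S/(x_1, ..., x_d). *)
Definition diffK (i : nat) : 'M[K]_(rk F i.+1, rk F i) :=
  map_mx (mcoeff 0%MM) (diff F i).

(* Row space: the degree j component of F_i (x)_S K. *)
Definition degpart (i j : nat) : 'M[K]_(rk F i) :=
  diag_mx (\row_a (gdeg a == j)%:R).

Definition cycles (i j : nat) : 'M[K]_(rk F i) :=
  match i with
  | 0 => degpart 0 j
  | i'.+1 => (degpart i'.+1 j :&: kermx (diffK i'))%MS
  end.

Definition boundaries (i j : nat) : 'M[K]_(rk F i.+1, rk F i) :=
  degpart i.+1 j *m diffK i.

(* dim_K H_i(F (x)_S K)_j *)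
Definition tor_dim (i j : nat) : nat :=
  (\rank (cycles i j) - \rank (boundaries i j))%N.

End Tor.

(* dim_K Tor_i^S(S/J, K)_j, computed from a graded free resolution of S/J. *)
Definition betti (J : S -> Prop) (i j : nat) : nat :=
  xget 0%N (fun b => exists2 F : free_complex,
    graded_free_resolution J F & b = tor_dim F i j).

End Betti.

(** * The limiting generating function *)

(* A formal power series in x and t over the integers; [f i j] is the
   coefficient of x^i t^j. *)
Definition series2 : Type := nat -> nat -> int.

Definition mono2 (a b : nat) : series2 :=
  fun i j => ((i == a) && (j == b))%:R.

Definition add2 (f g : series2) : series2 := fun i j => f i j + g i j.

Definition sub2 (f g : series2) : series2 := fun i j => f i j - g i j.

Definition mul2 (f g : series2) : series2 := fun i j =>
  \sum_(a < i.+1) \sum_(b < j.+1) f a b * g (i - a)%N (j - b)%N.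

Definition one2 : series2 := mono2 0 0.

Definition exp2 (f : series2) (m : nat) : series2 := iter m (mul2 f) one2.

(* The equation for G is multiplied by x^(k-1) to stay within power series. *)
Definition is_limit_series (k : nat) (G : series2) : Prop :=
  (exists2 w : series2, w 0%N 0%N = 0 & G = mul2 (mono2 1 0) w) /\
  mul2 (mono2 k.-1 0) G =
    exp2 (sub2 (mul2 (add2 one2 (mono2 1 1)) (add2 one2 G)) one2) k.

Definition betti_limit (k i j : nat) : int :=
  xget 0 (fun c => exists2 G : series2, is_limit_series k G & c = G i j).

Definition qstar (R : realType) (k : nat) : R :=
  (k%:R - 1) / k%:R ^+ 2 * exp.powR k%:R ((k%:R - 2) / (k%:R - 1)).

Definition agree_below (K : fieldType) (k n i M : nat) : Prop :=
  forall j : nat, (j < M)%N ->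
    (betti (@cut_ideal K k n) i j)%:Z = betti_limit k i j.

(* Main.v *)
Require Import Defs.
From HB Require Import structures.
From mathcomp Require Import all_boot all_order all_algebra.
From mathcomp Require Import boolp classical_sets reals.
From mathcomp Require Import mpoly.
From mathcomp Require Import zify ring.

Set Implicit Arguments.
Unset Strict Implicit.
Unset Printing Implicit Defensive.

Import Order.TTheory GRing.Theory Num.Theory.
Local Open Scope ring_scope.

(** Everything rests on the equality of the Betti numbers of J_{k,n} with the
    coefficients of an explicit sequence of power series.  Put w_0 = 0 and
      w_{n+1} = (t + w_n + t x w_n)^k.
    For i >= 1, beta_{i,j}(J_{k,n}) is the coefficient of x^(i-1) t^j in w_n,
    and the series G = x w solves the limit equation exactly when
    w = (t + w + t x w)^k.  Three facts then give the theorem.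

    - The right-hand side is monotone in w and w_0 = 0, so the w_n increase
      coefficientwise.  Since k >= 2, the right-hand side also improves by one
      the total degree up to which two series without constant term agree, so
      the w_n converge to the unique solution w, and w_n <= w_{n+1} <= w.  An
      agreement between w_n and w therefore persists for all larger n
      ([agree_below_mono]).
    - For fixed i, the coefficient of x^i in w_n is a polynomial in t, while the
      one in w has infinitely many positive terms ([wlim_unbounded]); so
      w_n and w disagree somewhere, and N(n, i) is the first place where they do.
    - For i = 0 the Betti number 1 in degree 0 never agrees with the limit, and
      N(n, 0) = 0.

    The Betti numbers come from an explicit minimal resolution.  Generalise J_{k,n}
    to the ideals of monomials that cut all the paths below each node of some list
    of pairwise incomparable nodes.  If x is the edge leading to a node v, if A is
    the ideal attached to the other nodes, and B that obtained by adding the paths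
    below v, then cutting also at or below v gives x A + B.  Here B is contained in
    A and neither involves x, so the mapping cone of B -> x A + B (direct sum) given
    by the inclusion and by x resolves x A + B ([cone_resolution]).  The
    generators of B have a multidegree that involves an edge below v, those of
    A do not; hence a multigraded lift of the inclusion has entries in the maximal
    ideal and the cone is minimal ([resolvable_split]).  In generating functions,
      P(x A + B) = t P(A) + (1 + t x) P(B),
    from which the recursion for w_n follows by induction on the height
    ([resolvable_cut_below]).

    Finally the Betti numbers are defined from an arbitrary graded free
    resolution, so the independence of Tor of the resolution is needed
    ([tor_dim_le]): two resolutions are linked by homogeneous chain maps that are
    mutually inverse up to a homogeneous homotopy. *)

(** * Homogeneous matrices and lifting of chain maps *)

Section MonomialSupport.
Variables (K : fieldType) (d : nat).
Notation S := {mpoly K[d]}.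
Notation mon := 'X_{1..d}.

Lemma msupp_sum_mul (I : finType) (f g : I -> S) (u : mon) :
  u \in msupp (\sum_i f i * g i) ->
  exists i v w, [/\ v \in msupp (f i), w \in msupp (g i) & u = (v + w)%MM].
Proof.
move=> /msupp_sum_le /flattenP[s /mapP[i _ ->]] /msuppM_le /allpairsP[[v w] /=].
by case=> vf wg ->; exists i, v, w.
Qed.

Definition mfilter (Q : pred mon) (p : S) : S :=
  \sum_(u <- msupp p | Q u) p@_u *: 'X_[u].

Lemma mcoeff_mfilter (Q : pred mon) (p : S) (u : mon) :
  (mfilter Q p)@_u = if Q u then p@_u else 0.
Proof.
rewrite /mfilter raddf_sum /=.
under eq_bigr do rewrite mcoeffZ mcoeffX.
have [up|up] := boolP (u \in msupp p); last first.
  rewrite (memN_msupp_eq0 up) if_same big1_seq // => v /andP[_ vp].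
  by rewrite (_ : v == u = false) ?mulr0 //; apply: contraNF up => /eqP <-.
rewrite big_mkcond (bigD1_seq u) ?msupp_uniq //= eqxx mulr1.
rewrite big1 ?addr0 // => v /negPf ->.
by rewrite mulr0 if_same.
Qed.

Lemma msupp_mfilter (Q : pred mon) (p : S) (u : mon) :
  (u \in msupp (mfilter Q p)) = Q u && (u \in msupp p).
Proof. by rewrite !mcoeff_msupp mcoeff_mfilter; case: (Q u); rewrite //= eqxx. Qed.

End MonomialSupport.

Section HomogeneousMatrices.
Variables (K : fieldType) (d : nat).
Notation S := {mpoly K[d]}.
Notation mon := 'X_{1..d}.
(* Degrees live in a set V on which monomials act.  This covers both the standard
   grading, needed to compare arbitrary resolutions, and the multigrading, needed
   to see that the mapping cone is minimal. *)
Variables (V : eqType) (act : mon -> V -> V).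
Hypothesis act0 : forall x, act 0%MM x = x.
Hypothesis actD : forall u v x, act (u + v)%MM x = act u (act v x).

(** These are the matrices of degree 0 maps between free modules whose generators
    have the degrees listed in al and be, with vectors written as rows. *)
Definition gradedmx p q (al : 'rV[V]_p) (be : 'rV[V]_q) (M : 'M[S]_(p, q)) : Prop :=
  forall a b u, u \in msupp (M a b) -> act u (be 0 b) = al 0 a.

Lemma graded_mul p q r (al : 'rV_p) (be : 'rV_q) (ga : 'rV_r) M N :
  gradedmx al be M -> gradedmx be ga N -> gradedmx al ga (M *m N).
Proof.
move=> hM hN a c u; rewrite mxE => /msupp_sum_mul[b [v [w [vM wN ->]]]].
by rewrite actD (hN _ _ _ wN) (hM _ _ _ vM).
Qed.

Lemma graded_add p q (al : 'rV_p) (be : 'rV_q) M N :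
  gradedmx al be M -> gradedmx al be N -> gradedmx al be (M + N).
Proof.
move=> hM hN a b u; rewrite mxE => /msuppD_le.
by rewrite mem_cat => /orP[/hM|/hN].
Qed.

Lemma graded_opp p q (al : 'rV_p) (be : 'rV_q) M :
  gradedmx al be M -> gradedmx al be (- M).
Proof.
by move=> hM a b u; rewrite mxE (perm_mem (msuppN _)) => /hM.
Qed.

Lemma graded0 p q (al : 'rV_p) (be : 'rV_q) : gradedmx al be 0.
Proof. by move=> a b u; rewrite mxE msupp0. Qed.

Lemma graded1 p (al : 'rV_p) : gradedmx al al 1%:M.
Proof.
move=> a b u; rewrite mxE; case: eqP => [->|_]; last by rewrite msupp0.
by rewrite msupp1 inE => /eqP ->; rewrite act0.
Qed.

Definition hpart p q (al : 'rV[V]_p) (be : 'rV[V]_q) (M : 'M[S]_(p, q)) :=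
  \matrix_(a, b) mfilter (fun u => act u (be 0 b) == al 0 a) (M a b).

Lemma graded_hpart p q (al : 'rV_p) (be : 'rV_q) M : gradedmx al be (hpart al be M).
Proof. by move=> a b u; rewrite mxE msupp_mfilter => /andP[/eqP]. Qed.

Lemma hpart_id p q (al : 'rV_p) (be : 'rV_q) M :
  gradedmx al be M -> hpart al be M = M.
Proof.
move=> hM; apply/matrixP=> a b; apply/mpolyP=> u.
rewrite mxE mcoeff_mfilter; case: eqP => // ne.
by rewrite memN_msupp_eq0 //; apply/negP => /hM.
Qed.

(** Multiplying a term of the wrong degree by an entry of a homogeneous matrix
    leaves it in a wrong degree. *)
Lemma hpart_mul p q r (al : 'rV_p) (be : 'rV_q) (ga : 'rV_r) M N :
  gradedmx be ga N -> hpart al be M *m N = hpart al ga (M *m N).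
Proof.
move=> hN; apply/matrixP=> a c; apply/mpolyP=> u.
rewrite [in RHS]mxE mcoeff_mfilter; case: eqP => [e|ne]; last first.
  apply: memN_msupp_eq0; apply/negP => hu; apply: ne.
  exact: (graded_mul (@graded_hpart _ _ al be M) hN hu).
apply/eqP; rewrite eq_sym -subr_eq0 -mcoeffB.
have -> : (M *m N) a c - (hpart al be M *m N) a c =
          ((M - hpart al be M) *m N) a c by rewrite mulmxBl [in RHS]mxE [X in _ = _ + X]mxE.
rewrite mcoeff_eq0; apply/negP; rewrite mxE => /msupp_sum_mul[b [v [w]]].
rewrite !mxE => -[+ /hN wN euw].
rewrite mcoeff_msupp mcoeffB mcoeff_mfilter -wN -actD -euw e eqxx.
by rewrite subrr eqxx.
Qed.

Lemma hpartB p q (al : 'rV_p) (be : 'rV_q) M N :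
  hpart al be (M - N) = hpart al be M - hpart al be N.
Proof.
apply/matrixP=> a b; apply/mpolyP=> u.
rewrite !mxE mcoeffB !mcoeff_mfilter mcoeffB; case: ifP => // _.
by rewrite subr0.
Qed.

Lemma rowwise_factor p q r (M : 'M[S]_(p, q)) (N : 'M[S]_(r, q)) :
  (forall a, exists v, row a M = v *m N) -> exists X, M = X *m N.
Proof.
case/fin_all_exists => f fP; exists (\matrix_a f a).
by apply/row_matrixP => a; rewrite row_mul rowK.
Qed.

(** Any solution of M = X N can be replaced by its homogeneous part; this is how
    every lift below is made homogeneous. *)
Lemma graded_factor p q r (al : 'rV_p) (be : 'rV_r) (ga : 'rV_q)
    (M : 'M_(p, q)) (N : 'M_(r, q)) :
  gradedmx al ga M -> gradedmx be ga N ->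
  (forall a, exists v, row a M = v *m N) ->
  exists2 X, gradedmx al be X & M = X *m N.
Proof.
move=> hM hN /rowwise_factor[X e]; exists (hpart al be X).
  exact: graded_hpart.
by rewrite (hpart_mul _ _ hN) -e hpart_id.
Qed.

Record chain := Chain {
  crk : nat -> nat;
  cdeg : forall i, 'rV[V]_(crk i);
  cdiff : forall i, 'M[S]_(crk i.+1, crk i) }.

Definition graded_chain (C : chain) :=
  forall i, gradedmx (cdeg C i.+1) (cdeg C i) (cdiff C i).

Definition exact_at m n p (M : 'M[S]_(m, n)) (N : 'M[S]_(n, p)) :=
  forall v : 'rV_n, v *m N = 0 <-> exists u, v = u *m M.

Definition acyclic (C : chain) :=
  forall i, exact_at (cdiff C i.+1) (cdiff C i).

Lemma exact_comp m n p (M : 'M[S]_(m, n)) (N : 'M[S]_(n, p)) :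
  exact_at M N -> M *m N = 0.
Proof.
move=> ex; apply/row_matrixP => a; rewrite row_mul row0.
by apply: (proj2 (ex _)); exists (delta_mx 0 a); rewrite -rowE.
Qed.

Lemma exact_factor m n p q (M : 'M[S]_(m, n)) (N : 'M[S]_(n, p))
    (be : 'rV_n) (al : 'rV_q) (ga : 'rV_m) (X : 'M_(q, n)) :
  exact_at M N -> gradedmx al be X -> gradedmx ga be M -> X *m N = 0 ->
  exists2 Y, gradedmx al ga Y & X = Y *m M.
Proof.
move=> ex hX hM XN; apply: (graded_factor hX hM) => a.
by apply: (proj1 (ex _)); rewrite -row_mul XN row0.
Qed.

Section Lifting.
Variables C D : chain.
Hypotheses (hC : graded_chain C) (hD : graded_chain D).

Definition graded_map (f : forall i, 'M[S]_(crk C i, crk D i)) :=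
  forall i, gradedmx (cdeg C i) (cdeg D i) (f i).

Definition chain_map (f : forall i, 'M[S]_(crk C i, crk D i)) :=
  forall i, f i.+1 *m cdiff D i = cdiff C i *m f i.

(** The comparison theorem: each component is obtained from the previous one by
    exactness of the target. *)
Lemma chain_lift (f0 : 'M_(crk C 0, crk D 0)) :
  (forall i, cdiff C i.+1 *m cdiff C i = 0) -> acyclic D ->
  gradedmx (cdeg C 0) (cdeg D 0) f0 ->
  (exists Y, cdiff C 0 *m f0 = Y *m cdiff D 0) ->
  exists f, [/\ graded_map f, chain_map f & f 0%N = f0].
Proof.
move=> compl acD hf0 [Y eY].
(* Classical choice at each level turns the successive existence statements into
   a sequence. *)
pose good i (fi : 'M_(crk C i, crk D i)) (X : 'M_(crk C i.+1, crk D i.+1)) :=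
  gradedmx (cdeg C i.+1) (cdeg D i.+1) X /\ X *m cdiff D i = cdiff C i *m fi.
pose f := fix f i : 'M_(crk C i, crk D i) :=
  match i with
  | 0 => f0
  | i'.+1 => xget 0 [set X | good i' (f i') X]
  end.
have fP i : gradedmx (cdeg C i) (cdeg D i) (f i) /\ good i (f i) (f i.+1).
  elim: i => [|i [_ [hf ef]]].
    split=> //=; apply: xgetPex.
    have [|||X hX eX] := @graded_factor _ _ _ (cdeg C 1) (cdeg D 1) (cdeg D 0)
        (cdiff C 0 *m f0) (cdiff D 0).
    - exact: graded_mul (@hC 0%N) hf0.
    - exact: hD.
    - by move=> a; exists (row a Y); rewrite eY row_mul.
    by exists X; split.
  split=> //=; apply: xgetPex.
  have [||||X hX eX] := @exact_factor _ _ _ _ (cdiff D i.+1) (cdiff D i)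
      (cdeg D i.+1) (cdeg C i.+2) (cdeg D i.+2) (cdiff C i.+1 *m f i.+1).
  - exact: acD.
  - exact: graded_mul (@hC i.+1) hf.
  - exact: hD.
  - by rewrite -mulmxA ef mulmxA compl mul0mx.
  by exists X; split.
exists f; split=> // i; first by case: (fP i).
by case: (fP i) => _ [].
Qed.

Definition homotopy (f : forall i, 'M[S]_(crk C i, crk D i))
    (h : forall i, 'M[S]_(crk C i, crk D i.+1)) :=
  f 0%N = h 0%N *m cdiff D 0 /\
  forall i, f i.+1 = h i.+1 *m cdiff D i.+1 + cdiff C i *m h i.

Lemma null_homotopy f :
  (forall i, cdiff C i.+1 *m cdiff C i = 0) -> acyclic D ->
  graded_map f -> chain_map f ->
  (exists X, f 0%N = X *m cdiff D 0) ->
  exists2 h, homotopy f h & forall i, gradedmx (cdeg C i) (cdeg D i.+1) (h i).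
Proof.
move=> compl acD hf cf [X0 eX0].
pose goodS i (hi : 'M_(crk C i, crk D i.+1)) (X : 'M_(crk C i.+1, crk D i.+2)) :=
  gradedmx (cdeg C i.+1) (cdeg D i.+2) X /\
  X *m cdiff D i.+1 = f i.+1 - cdiff C i *m hi.
pose good0 (X : 'M_(crk C 0, crk D 1)) :=
  gradedmx (cdeg C 0) (cdeg D 1) X /\ f 0%N = X *m cdiff D 0.
pose h := fix h i : 'M_(crk C i, crk D i.+1) :=
  match i with
  | 0 => xget 0 [set X | good0 X]
  | i'.+1 => xget 0 [set X | goodS i' (h i') X]
  end.
have [h0 e0] : good0 (h 0%N).
  apply: xgetPex.
  have [|||X hX eX] := @graded_factor _ _ _ (cdeg C 0) (cdeg D 1) (cdeg D 0)
      (f 0%N) (cdiff D 0); [exact: hf|exact: hD| |by exists X].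
  by move=> a; exists (row a X0); rewrite eX0 row_mul.
have hP i : gradedmx (cdeg C i) (cdeg D i.+1) (h i) /\ goodS i (h i) (h i.+1).
  elim: i => [|i [hhi [hh eh]]]; (split; first by []); apply: xgetPex.
    have [||||X hX eX] := @exact_factor _ _ _ _ (cdiff D 1) (cdiff D 0)
      (cdeg D 1) (cdeg C 1) (cdeg D 2) (f 1%N - cdiff C 0 *m h 0%N).
    - exact: acD.
    - by apply: graded_add => //; apply/graded_opp/graded_mul; [exact: hC|].
    - exact: hD.
    - by rewrite mulmxBl cf -mulmxA e0 subrr.
    by exists X; split.
  have [||||X hX eX] := @exact_factor _ _ _ _ (cdiff D i.+2) (cdiff D i.+1)
    (cdeg D i.+2) (cdeg C i.+2) (cdeg D i.+3) (f i.+2 - cdiff C i.+1 *m h i.+1).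
  - exact: acD.
  - by apply: graded_add => //; apply/graded_opp/graded_mul; [exact: hC|].
  - exact: hD.
  - rewrite mulmxBl cf -mulmxA eh mulmxBr opprB addrC addrNK.
    by rewrite mulmxA compl mul0mx.
  by exists X; split.
exists h; last by move=> i; case: (hP i).
split=> // i; case: (hP i) => _ [_ ->]; by rewrite addrNK.
Qed.

End Lifting.
End HomogeneousMatrices.

(** * Betti numbers do not depend on the resolution *)

Section HomologyRank.
Variable K : fieldType.

(** If g f is the identity up to boundaries, then f is injective on homology: a
    complement of B in Z is mapped injectively, and its image meets B' in 0. *)
Lemma homology_rank_le n m z b z' b' (Z : 'M[K]_(z, n)) (B : 'M_(b, n))
    (Z' : 'M[K]_(z', m)) (B' : 'M_(b', m)) (f : 'M_(n, m)) (g : 'M_(m, n)) :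
  (B <= Z)%MS -> (Z *m f <= Z')%MS -> (B' <= Z')%MS -> (B' *m g <= B)%MS ->
  (Z *m (f *m g - 1%:M) <= B)%MS ->
  (\rank Z - \rank B <= \rank Z' - \rank B')%N.
Proof.
move=> sBZ sZf sBZ' sBg sh; pose C := (Z :\: B)%MS.
have rC : (\rank C = \rank Z - \rank B)%N.
  rewrite -(mxrank_cap_compl Z B) addnC.
  suff -> : \rank (Z :&: B) = \rank B by rewrite addnK.
  by apply: eqmx_rank; rewrite capmxSr sub_capmx sBZ submx_refl.
have key (c : 'rV_n) : (c <= C)%MS -> (c *m f <= B')%MS -> c = 0.
  move=> cC cB; apply/eqP; rewrite -submx0 -(capmx_diff Z B) sub_capmx cC /=.
  have -> : c = c *m f *m g - c *m (f *m g - 1%:M).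
    by rewrite mulmxBr mulmx1 mulmxA opprB addrC addrNK.
  rewrite addmx_sub ?eqmx_opp //; first exact: submx_trans (submxMr _ cB) sBg.
  exact: submx_trans (submxMr _ (submx_trans cC (diffmxSl _ _))) sh.
have dis : (C *m f :&: B')%MS = 0.
  apply/eqP/rowV0P => v; rewrite sub_capmx => /andP[/submxP[w ev] vB].
  rewrite ev mulmxA (key (w *m C)) ?mul0mx ?submxMl //.
  by rewrite -mulmxA -ev.
have inj : \rank (C *m f) = \rank C.
  apply/mxrank_injP/rowV0P => v; rewrite sub_capmx => /andP[vC /sub_kermxP vf].
  by apply: key => //; rewrite vf sub0mx.
rewrite -rC -inj leq_subRL ?mxrankS // addnC -mxrank_disjoint_sum //.
apply: mxrankS; rewrite addsmx_sub sBZ' andbT.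
exact: submx_trans (submxMr _ (diffmxSl _ _)) sZf.
Qed.

End HomologyRank.

Section TorInvariance.
Variables (K : fieldType) (d : nat).
Notation S := {mpoly K[d]}.
Notation mon := 'X_{1..d}.

Definition mon_ideal (U : pred mon) (p : S) : Prop := {in msupp p, forall u, U u}.

Definition upclosed (U : pred mon) := forall u v : mon, U u -> U (u + v)%MM.

Lemma mon_ideal0 U : mon_ideal U 0.
Proof. by move=> u; rewrite msupp0. Qed.

Lemma mon_idealD U p q : mon_ideal U p -> mon_ideal U q -> mon_ideal U (p + q).
Proof. by move=> hp hq u /msuppD_le; rewrite mem_cat => /orP[/hp|/hq]. Qed.

Lemma mon_idealN U p : mon_ideal U p -> mon_ideal U (- p).
Proof. by move=> hp u; rewrite (perm_mem (msuppN _)) => /hp. Qed.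

Lemma mon_ideal_mulmx U m n (M : 'M[S]_(m, n)) (v : 'cV_n) :
  upclosed U -> (forall b, mon_ideal U (v b 0)) ->
  forall a, mon_ideal U ((M *m v) a 0).
Proof.
move=> upU hv a u; rewrite mxE => /msupp_sum_mul[b [x [y [_ hy ->]]]].
by rewrite addmC; apply/upU/(hv b).
Qed.

Lemma row_mul_entry m n p (M : 'M[S]_(m, n)) (N : 'M_(n, p)) a b :
  (row a M *m N) 0 b = (M *m N) a b.
Proof. by rewrite -row_mul mxE. Qed.

Definition deg_act (u : mon) (j : nat) : nat := (mdeg u + j)%N.

Lemma deg_act0 j : deg_act 0%MM j = j.
Proof. by rewrite /deg_act mdeg0. Qed.

Lemma deg_actD u v j : deg_act (u + v)%MM j = deg_act u (deg_act v j).
Proof. by rewrite /deg_act mdegD addnA. Qed.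

Definition reduce m n (M : 'M[S]_(m, n)) : 'M[K]_(m, n) :=
  map_mx (mcoeff 0%MM) M.

Lemma reduceM m n p (M : 'M[S]_(m, n)) (N : 'M_(n, p)) :
  reduce (M *m N) = reduce M *m reduce N.
Proof. exact: map_mxM. Qed.

Lemma reduce0 m n : reduce (0 : 'M[S]_(m, n)) = 0.
Proof. exact: map_mx0. Qed.

Lemma reduceD m n (M N : 'M[S]_(m, n)) : reduce (M + N) = reduce M + reduce N.
Proof. exact: map_mxD. Qed.

Lemma reduceB m n (M N : 'M[S]_(m, n)) : reduce (M - N) = reduce M - reduce N.
Proof. exact: map_mxB. Qed.

Lemma reduce1 n : reduce (1%:M : 'M[S]_n) = 1%:M.
Proof. exact: map_mx1. Qed.

Definition degsel n (al : 'rV[nat]_n) (j : nat) : 'M[K]_n :=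
  diag_mx (\row_a (al 0 a == j)%:R).

(** Only the constant term survives modulo the variables, and in a homogeneous
    matrix it can be nonzero only between generators of equal degree. *)
Lemma degsel_reduce m n (al : 'rV_m) (be : 'rV_n) (M : 'M[S]_(m, n)) j :
  gradedmx deg_act al be M ->
  degsel al j *m reduce M = reduce M *m degsel be j.
Proof.
move=> hM; apply/matrixP => a b; rewrite mul_diag_mx mul_mx_diag !mxE.
have [u0|u0] := boolP (0%MM \in msupp (M a b)).
  by rewrite -(hM _ _ _ u0) deg_act0 mulrC.
by rewrite (memN_msupp_eq0 u0) mulr0 mul0r.
Qed.

Definition chain_of (F : free_complex K d) : chain K d nat :=
  Chain (fun i => \row_a @gdeg _ _ F i a) (diff F).

Section Comparison.
Variable (U : pred mon).
Hypothesis upU : upclosed U.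
Notation J := (mon_ideal U).

Lemma resolution_chain F : graded_free_resolution J F ->
  [/\ graded_chain deg_act (chain_of F), acyclic (chain_of F),
      forall i, diff F i.+1 *m diff F i = 0 &
      gradedmx deg_act (\row_a @gdeg _ _ F 0 a) (const_mx 0%N) (aug F)].
Proof.
case=> hd ha _ _ ex; split.
- by move=> i a b u /hd; rewrite !mxE.
- exact: ex.
- by move=> i; apply: exact_comp; apply: ex.
by move=> a b u; rewrite (ord1 b) => /ha e; rewrite !mxE /deg_act addn0.
Qed.

(** The lift at level 0 is only a lift modulo J; its homogeneous part is again one
    because J is spanned by monomials. *)
Lemma comparison F F' :
  graded_free_resolution J F -> graded_free_resolution J F' ->
  exists f, [/\ graded_map deg_act f,
    @chain_map _ _ _ (chain_of F) (chain_of F') f &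
    forall b, J ((aug F - f 0%N *m aug F') b 0)].
Proof.
move=> RF RF'; have [hF acF ddF hauF] := resolution_chain RF.
have [hF' acF' ddF' hauF'] := resolution_chain RF'.
have [_ _ surj ex0 _] := RF'; have [_ _ _ ex0F _] := RF.
have [x xP] := fin_all_exists (fun b => surj (aug F b 0)).
pose f0 := hpart deg_act (cdeg (chain_of F) 0) (cdeg (chain_of F') 0)
  (\matrix_b x b).
have hf0 : gradedmx deg_act (cdeg (chain_of F) 0) (cdeg (chain_of F') 0) f0.
  exact: graded_hpart.
have Jf0 b : J ((aug F - f0 *m aug F') b 0).
  rewrite (hpart_mul deg_actD _ _ hauF') -{1}(hpart_id hauF) -hpartB.
  move=> u; rewrite mxE msupp_mfilter => /andP[_].
  suff -> : (aug F - (\matrix_b0 x b0) *m aug F') b 0 =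
            aug F b 0 - (x b *m aug F') 0 0 by apply: xP.
  rewrite [LHS]mxE [X in _ + X]mxE; congr (_ - _).
  rewrite [in LHS]mxE [in RHS]mxE; apply: eq_bigr => c _; by rewrite mxE.
have [|Y eY] := @rowwise_factor _ _ _ _ _ (diff F 0 *m f0) (diff F' 0).
  move=> a; apply/ex0; rewrite row_mul_entry.
  have -> : diff F 0 *m f0 *m aug F' =
      diff F 0 *m aug F - diff F 0 *m (aug F - f0 *m aug F').
    by rewrite mulmxBr mulmxA opprB addrC addrNK.
  rewrite mxE [X in _ + X]mxE.
  apply: mon_idealD; last exact/mon_idealN/mon_ideal_mulmx.
  rewrite -row_mul_entry.
  by apply/ex0F; exists (delta_mx 0 a); rewrite -rowE.
have [f [hf cf ef0]] := chain_lift deg_actD hF hF' ddF acF' hf0 (ex_intro _ Y eY).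
by exists f; split=> // b; rewrite ef0.
Qed.

(** The difference between 1 and the composite of the two comparison maps is null
    homotopic, and remains so after reduction modulo the variables. *)
Lemma tor_dim_le F F' i j :
  graded_free_resolution J F -> graded_free_resolution J F' ->
  (tor_dim F i j <= tor_dim F' i j)%N.
Proof.
move=> RF RF'; have [hF acF ddF hauF] := resolution_chain RF.
have [hF' acF' ddF' hauF'] := resolution_chain RF'.
have [f [hf cf Jf]] := comparison RF RF'.
have [g [hg cg Jg]] := comparison RF' RF.
pose e (i : nat) : 'M[S]_(rk F i, rk F i) := f i *m g i - 1%:M.
have he : @graded_map _ _ _ deg_act (chain_of F) (chain_of F) e.
  move=> l; apply: graded_add; first exact: (graded_mul deg_actD (@hf l) (@hg l)).
  exact/graded_opp/graded1/deg_act0.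
have ce : @chain_map _ _ _ (chain_of F) (chain_of F) e.
  move=> l; rewrite /e mulmxBl mulmxBr mul1mx mulmx1 -mulmxA cg.
  by rewrite !mulmxA cf.
have [X eX] : exists X, e 0%N = X *m diff F 0.
  apply: rowwise_factor => a; have [_ _ _ ex0F _] := RF; apply/ex0F.
  rewrite row_mul_entry.
  have -> : e 0%N *m aug F =
      - (aug F - f 0%N *m aug F') - f 0%N *m (aug F' - g 0%N *m aug F).
    rewrite /e mulmxBl mul1mx mulmxBr mulmxA !opprB.
    by rewrite [RHS]addrC [RHS]addrA addrNK.
  rewrite mxE ![(- _ : matrix _ _ _) _ _]mxE.
  apply: mon_idealD; first exact/mon_idealN.
  exact/mon_idealN/mon_ideal_mulmx.
have [h [h0 hS] hh] := null_homotopy deg_actD (C := chain_of F) (D := chain_of F)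
  hF hF ddF acF he ce (ex_intro _ X eX).
pose dg (F : free_complex K d) i := cdeg (chain_of F) i.
have degE G l : degpart G l j = degsel (dg G l) j.
  by congr diag_mx; apply/rowP => a; rewrite !mxE.
have dK G l (RG : graded_free_resolution J G) :
    degpart G l.+1 j *m diffK G l = diffK G l *m degpart G l j.
  rewrite !degE; apply: degsel_reduce.
  by have [hG _ _ _] := resolution_chain RG; apply: hG.
have ddK G l (RG : graded_free_resolution J G) :
    diffK G l.+1 *m diffK G l = 0.
  by rewrite -reduceM; have [_ _ -> _] := resolution_chain RG; rewrite reduce0.
have cyc G l (RG : graded_free_resolution J G) :
    (boundaries G l j <= cycles G l j)%MS.
  rewrite /boundaries; case: l => [|l] /=; first by rewrite dK // submxMl.
  rewrite sub_capmx dK // submxMl /=; apply/sub_kermxP.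
  by rewrite -dK // -mulmxA ddK // mulmx0.
have cycdeg (G : free_complex K d) l : (cycles G l j <= degpart G l j)%MS.
  by case: l => [|l] //=; apply: capmxSl.
have fK l : degpart F l j *m reduce (f l) = reduce (f l) *m degpart F' l j.
  by rewrite !degE; apply: degsel_reduce; apply: hf.
have gK l : degpart F' l j *m reduce (g l) = reduce (g l) *m degpart F l j.
  by rewrite !degE; apply: degsel_reduce; apply: hg.
have hK l : degpart F l j *m reduce (h l) = reduce (h l) *m degpart F l.+1 j.
  by rewrite !degE; apply: degsel_reduce; apply: hh.
have bnd l : (cycles F l j *m (reduce (h l) *m diffK F l) <= boundaries F l j)%MS.
  have /submxP[w ->] := cycdeg F l.
  by rewrite -mulmxA [degpart _ _ _ *m _]mulmxA hK -mulmxA; do 2!apply: mulmx_sub.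
apply: (@homology_rank_le _ _ _ _ _ _ _ _ _ _ _ (reduce (f i)) (reduce (g i))).
- exact: cyc.
- case: i => [|i] /=; first by rewrite fK submxMl.
  rewrite sub_capmx; apply/andP; split.
    apply: submx_trans (submxMr _ (capmxSl _ _)) _.
    by rewrite fK submxMl.
  apply/sub_kermxP; rewrite -mulmxA -reduceM cf reduceM mulmxA.
  by have /sub_kermxP -> := capmxSr (degpart F i.+1 j) (kermx (diffK F i)); rewrite mul0mx.
- exact: cyc.
- rewrite /boundaries -mulmxA -reduceM -cg reduceM mulmxA gK -mulmxA submxMl.
  by [].
- rewrite -reduceM -reduce1 -reduceB -/(e i).
  case: i => [|i]; first by rewrite h0 reduceM; apply: bnd.
  rewrite hS reduceD mulmxDr addmx_sub // reduceM ?bnd //.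
  rewrite mulmxA (_ : cycles F i.+1 j *m reduce (diff F i) = 0) ?mul0mx ?sub0mx //.
  by apply/sub_kermxP; apply: capmxSr.
Qed.

Lemma betti_eq F i j :
  graded_free_resolution J F -> betti J i j = tor_dim F i j.
Proof.
move=> RF; apply: xget_unique; first by exists F.
move=> _ [F' RF' ->]; apply/eqP; rewrite eqn_leq.
by rewrite !tor_dim_le.
Qed.

End Comparison.
End TorInvariance.

(** * The mapping cone of a vertex splitting *)

Section GradedBlocks.
Variables (K : fieldType) (d : nat).
Notation S := {mpoly K[d]}.
Notation mon := 'X_{1..d}.
Variables (V : eqType) (act : mon -> V -> V).
Notation gradedmx := (gradedmx act).

Lemma graded_row_mx p q r (al : 'rV_p) (be : 'rV_q) (ga : 'rV_r)
    (M : 'M[S]_(p, q)) (N : 'M[S]_(p, r)) :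
  gradedmx al be M -> gradedmx al ga N ->
  gradedmx al (row_mx be ga) (row_mx M N).
Proof.
move=> hM hN a b u; case: (splitP b) => c ec.
  have -> : b = lshift r c by apply: val_inj.
  by rewrite !row_mxEl => /hM.
have -> : b = rshift q c by apply: val_inj.
by rewrite !row_mxEr => /hN.
Qed.

Lemma graded_col_mx p q r (al : 'rV_p) (be : 'rV_q) (ga : 'rV_r)
    (M : 'M[S]_(p, r)) (N : 'M[S]_(q, r)) :
  gradedmx al ga M -> gradedmx be ga N ->
  gradedmx (row_mx al be) ga (col_mx M N).
Proof.
move=> hM hN a b u; case: (splitP a) => c ec.
  have -> : a = lshift q c by apply: val_inj.
  by rewrite col_mxEu row_mxEl => /hM.
have -> : a = rshift p c by apply: val_inj.
by rewrite col_mxEd row_mxEr => /hN.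
Qed.

End GradedBlocks.

Section MappingCone.
Variables (K : fieldType) (d : nat).
Notation S := {mpoly K[d]}.
Notation mon := 'X_{1..d}.

Definition mon_act (u m : mon) : mon := (u + m)%MM.

Lemma mon_act0 m : mon_act 0%MM m = m. Proof. exact: add0m. Qed.

Lemma mon_actD u v m : mon_act (u + v)%MM m = mon_act u (mon_act v m).
Proof. by rewrite /mon_act addmA. Qed.

(** A minimal multigraded resolution of the ideal spanned by the monomials in U,
    as a module: level 0 consists of the generators of the ideal.  The field
    mr_deg serves later splittings: it separates the multidegrees of nested
    ideals, which makes the cone minimal. *)
Record minimal_resolution (U : pred mon) (C : chain K d mon)
    (ep : 'cV[S]_(crk C 0)) : Prop := MinimalResolution {
  mr_graded : graded_chain mon_act C;
  mr_aug : gradedmx mon_act (cdeg C 0) (const_mx 0%MM) ep;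
  mr_min : forall i, reduce (cdiff C i) = 0;
  mr_image : forall p, mon_ideal U p <-> exists v : 'rV_(crk C 0), p = (v *m ep) 0 0;
  mr_exact0 : exact_at (cdiff C 0) ep;
  mr_acyclic : acyclic C;
  mr_deg : forall i a, U (cdeg C i 0 a) }.

Definition shift n (x : 'I_d) (al : 'rV[mon]_n) : 'rV[mon]_n :=
  map_mx (mon_act U_(x)%MM) al.

Lemma graded_shift m n x (al : 'rV_m) (be : 'rV_n) (M : 'M[S]_(m, n)) :
  gradedmx mon_act al be M -> gradedmx mon_act (shift x al) (shift x be) M.
Proof.
move=> hM a b u /hM e; rewrite !mxE -e /mon_act.
by rewrite addmA (addmC u) -addmA.
Qed.

Lemma graded_var n x (al : 'rV_n) :
  gradedmx mon_act (shift x al) al ('X_x : S)%:M.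
Proof.
move=> a b u; rewrite !mxE; case: eqP => [->|_]; last by rewrite msupp0.
by rewrite mulr1n msuppX inE => /eqP ->.
Qed.

Lemma mx11E (M : 'M[S]_1) : M = 0 <-> M 0 0 = 0.
Proof.
split=> [->|e]; first by rewrite mxE.
by apply/matrixP=> i j; rewrite !ord1 mxE.
Qed.

Lemma row_mx_ind m n (al : 'rV[mon]_m) (be : 'rV[mon]_n) (U : pred mon) :
  (forall c, U (al 0 c)) -> (forall c, U (be 0 c)) ->
  forall c, U (row_mx al be 0 c).
Proof.
move=> h1 h2 c; case: (splitP c) => e ee.
  have -> : c = lshift n e by apply: val_inj.
  by rewrite row_mxEl.
have -> : c = rshift m e by apply: val_inj.
by rewrite row_mxEr.
Qed.

Section Cone.
Variables (x : 'I_d) (A B : chain K d mon).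
Variables (eA : 'cV[S]_(crk A 0)) (eB : 'cV[S]_(crk B 0)).
Variable f : forall i, 'M[S]_(crk B i, crk A i).
Notation X := ('X_x : S).

(** The cone of the map from B to x A + B (direct sum) with components -f and x. *)
Definition cone_rk (i : nat) : nat :=
  match i with
  | 0 => crk A 0 + crk B 0
  | i'.+1 => (crk A i'.+1 + crk B i'.+1) + crk B i'
  end%N.

Definition cone_deg (i : nat) : 'rV[mon]_(cone_rk i) :=
  match i return 'rV[mon]_(cone_rk i) with
  | 0 => row_mx (shift x (cdeg A 0)) (cdeg B 0)
  | i'.+1 => row_mx (row_mx (shift x (cdeg A i'.+1)) (cdeg B i'.+1))
                    (shift x (cdeg B i'))
  end.

Definition sum_diff (i : nat) :
    'M[S]_(crk A i.+1 + crk B i.+1, crk A i + crk B i) :=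
  block_mx (cdiff A i) 0 0 (cdiff B i).

Definition cone_map (i : nat) : 'M[S]_(crk B i, crk A i + crk B i) :=
  row_mx (- f i) X%:M.

Definition cone_diff (i : nat) : 'M[S]_(cone_rk i.+1, cone_rk i) :=
  match i return 'M[S]_(cone_rk i.+1, cone_rk i) with
  | 0 => col_mx (sum_diff 0) (cone_map 0)
  | i'.+1 => block_mx (sum_diff i'.+1) 0 (cone_map i'.+1) (- cdiff B i')
  end.

Definition cone : chain K d mon := Chain cone_deg cone_diff.

Definition cone_aug : 'cV[S]_(cone_rk 0) := col_mx (X *: eA) eB.

Variables UA UB UC : pred mon.
Hypotheses (RA : minimal_resolution UA eA) (RB : minimal_resolution UB eB).
Hypotheses (xA : forall u, UA (U_(x) + u)%MM = UA u)
           (xB : forall u, UB (U_(x) + u)%MM = UB u).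
Hypothesis UCE : forall u, UC u = (0 < u x)%N && UA u || UB u.
Hypotheses (hf : @graded_map _ _ _ mon_act B A f) (cf : @chain_map _ _ _ B A f)
           (f0 : f 0%N *m eA = eB) (fmin : forall i, reduce (f i) = 0).

Lemma graded_sum_diff i :
  gradedmx mon_act (row_mx (shift x (cdeg A i.+1)) (cdeg B i.+1))
    (row_mx (shift x (cdeg A i)) (cdeg B i)) (sum_diff i).
Proof.
rewrite /sum_diff block_mxEv; apply: graded_col_mx; apply: graded_row_mx;
  by [apply/graded_shift/(mr_graded RA)|apply: graded0|apply: (mr_graded RB)].
Qed.

Lemma graded_cone_map i :
  gradedmx mon_act (shift x (cdeg B i))
    (row_mx (shift x (cdeg A i)) (cdeg B i)) (cone_map i).
Proof.
apply: graded_row_mx; last exact: graded_var.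
exact/graded_opp/graded_shift/hf.
Qed.

Lemma graded_cone : graded_chain mon_act cone.
Proof.
move=> [|i] /=.
  by apply: graded_col_mx; [exact: graded_sum_diff|exact: graded_cone_map].
rewrite block_mxEv; apply: graded_col_mx; apply: graded_row_mx.
- exact: graded_sum_diff.
- exact: graded0.
- exact: graded_cone_map.
- exact/graded_opp/graded_shift/(mr_graded RB).
Qed.

Lemma graded_cone_aug :
  gradedmx mon_act (cdeg cone 0) (const_mx 0%MM) cone_aug.
Proof.
apply: graded_col_mx; last exact: (mr_aug RB).
move=> a b u; rewrite mxE mulrC => hu.
have : u \in [seq (U_(x) + w)%MM | w <- msupp (eA a b)].
  by rewrite -(perm_mem (msuppMX _ _)).
case/mapP => w /(mr_aug RA) e ->.
by rewrite [RHS]mxE -e mon_actD.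
Qed.

Lemma cone_min i : reduce (cdiff cone i) = 0.
Proof.
have sd l : reduce (sum_diff l) = 0.
  rewrite /reduce map_block_mx -!/(reduce _).
  by rewrite (mr_min RA) (mr_min RB) !reduce0 block_mx0.
have sm l : reduce (cone_map l) = 0.
  rewrite /reduce map_row_mx map_mxN -!/(reduce _) fmin oppr0 /reduce map_scalar_mx.
  by rewrite /= mcoeffX mnm1_eq0 raddf0 row_mx0.
case: i => [|i] /=.
  by rewrite /reduce map_col_mx -!/(reduce _) sd sm col_mx0.
rewrite /reduce map_block_mx -!/(reduce _) sd sm reduce0.
by rewrite /reduce map_mxN -!/(reduce _) (mr_min RB) oppr0 block_mx0.
Qed.

(** Once the component along B is a boundary, subtracting the corresponding
    boundary of the cone leaves cycles of A and of B. *)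
Lemma cone_step i (a : 'rV_(crk A i.+1)) (b : 'rV_(crk B i.+1)) (c : 'rV_(crk B i)) :
  (exists e, c = e *m cdiff B i) ->
  row_mx a b *m sum_diff i + c *m cone_map i = 0 ->
  exists u, row_mx (row_mx a b) c = u *m cdiff cone i.+1.
Proof.
case=> e ->; rewrite mul_row_block mul_mx_row !mulmx0 addr0 add0r add_row_mx.
rewrite -row_mx0 => /eq_row_mx[ea eb].
have [u1 e1] : exists u, a - e *m f i.+1 = u *m cdiff A i.+1.
  apply: (proj1 (mr_acyclic RA (i := i) _)).
  rewrite mulmxBl -mulmxA cf mulmxA; move: ea.
  by rewrite mulmxN.
have [u2 e2] : exists u, b + X *: e = u *m cdiff B i.+1.
  apply: (proj1 (mr_acyclic RB (i := i) _)).
  rewrite mulmxDl -scalemxAl; move: eb.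
  by rewrite mul_mx_scalar.
exists (row_mx (row_mx u1 u2) (- e)) => /=.
rewrite !mul_row_block mul_mx_row !mulmx0 !addr0 !add0r.
rewrite !(mulNmx, mulmxN) !opprK add_row_mx -e1 -e2 mul_mx_scalar.
by rewrite subrK addrK.
Qed.

Lemma varI (p : S) : X * p = 0 -> p = 0.
Proof.
move/eqP; rewrite mulf_eq0 -msupp_eq0 msuppX /=; by move/eqP.
Qed.

Lemma mon_ideal_var U (p : S) : (forall u, U (U_(x) + u)%MM = U u) ->
  mon_ideal U (X * p) -> mon_ideal U p.
Proof.
move=> hU hp u up; rewrite -hU; apply: hp.
by rewrite [X * p]mulrC mcoeff_msupp mcoeffMX -mcoeff_msupp.
Qed.

(** If x p + q = 0 with p in A and q in B, then x p lies in B, hence so does p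
    since x is regular modulo B.  Writing p as a combination c of the generators of
    B and adding c times the rows -f and x of the cone leaves a relation of A and
    one of B. *)
Lemma cone_exact0 : exact_at (cdiff cone 0) cone_aug.
Proof.
have dA := exact_comp (mr_exact0 RA); have dB := exact_comp (mr_exact0 RB).
move=> v; split=> [|[u ->]]; last first.
  rewrite -mulmxA /= /cone_aug mul_col_mx mul_block_col mul_row_col.
  rewrite -!scalemxAr dA dB !mul0mx !addr0 mul_scalar_mx mulNmx f0.
  by rewrite scalerN addNr !scaler0 !col_mx0 mulmx0.
rewrite -[v]hsubmxK; set a := lsubmx v; set b := rsubmx v.
rewrite /cone_aug mul_row_col -scalemxAr => e.
have [c ec] : exists c : 'rV_(crk B 0), (a *m eA) 0 0 = (c *m eB) 0 0.
  apply: (proj1 (mr_image RB _)); apply: (mon_ideal_var xB).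
  have -> : X * (a *m eA) 0 0 = ((- b) *m eB) 0 0.
    apply/eqP; rewrite -subr_eq0; apply/eqP; move/mx11E: e => <-.
    by rewrite mulNmx [X in _ - X]mxE opprK [RHS]mxE [X in _ = X + _]mxE.
  by apply: (proj2 (mr_image RB _)); exists (- b).
have ea : a *m eA = c *m eB.
  by apply/matrixP => i j; rewrite !ord1.
have [u1 e1] : exists u, a - c *m f 0%N = u *m cdiff A 0.
  apply: (proj1 (mr_exact0 RA _)).
  by rewrite mulmxBl -mulmxA f0 ea subrr.
have [u2 e2] : exists u, b + X *: c = u *m cdiff B 0.
  apply: (proj1 (mr_exact0 RB _)).
  by rewrite mulmxDl -scalemxAl -ea addrC.
exists (row_mx (row_mx u1 u2) (- c)) => /=.
rewrite mul_row_col mul_row_block mul_mx_row !mulmx0 !addr0 !add0r.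
rewrite !(mulNmx, mulmxN) !opprK add_row_mx -e1 -e2 mul_mx_scalar.
by rewrite subrK addrK.
Qed.

(** In the lowest degree, x times the component of a cycle along B is a boundary;
    augmenting and cancelling x shows that this component is itself a relation of
    B.  In higher degrees it is a cycle of B because the cone has no other
    map into that summand. *)
Lemma cone_acyclic : acyclic cone.
Proof.
have ddA i := exact_comp (mr_acyclic RA (i := i)).
have ddB i := exact_comp (mr_acyclic RB (i := i)).
have dB := exact_comp (mr_exact0 RB).
have sd i : sum_diff i.+1 *m sum_diff i = 0.
  by rewrite mulmx_block !ddA !ddB !mulmx0 !mul0mx !addr0 block_mx0.
have sm i : cone_map i.+1 *m sum_diff i = cdiff B i *m cone_map i.
  rewrite mul_row_block mul_mx_row !mulmx0 addr0 add0r mulNmx cf mulmxN.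
  by rewrite mul_mx_scalar mul_scalar_mx.
have dd i : cdiff cone i.+1 *m cdiff cone i = 0.
  case: i => [|i] /=.
    rewrite mul_block_col sd mul0mx addr0 sm mulNmx subrr.
    by rewrite col_mx0.
  rewrite mulmx_block sd sm !mulmx0 !mul0mx !(addr0, add0r) mulNmx subrr.
  by rewrite mulmxN mulNmx opprK ddB block_mx0.
move=> i v; split=> [|[u ->]]; last by rewrite -mulmxA dd mulmx0.
rewrite -[v]hsubmxK -[lsubmx v]hsubmxK.
set a := lsubmx _; set b := rsubmx (lsubmx v); set c := rsubmx _.
case: i v a b c => [|i] v a b c /=.
  rewrite mul_row_col => e; apply: cone_step => //.
  apply: (proj1 (mr_exact0 RB _)).
  move: e; rewrite mul_row_block mul_mx_row !mulmx0 addr0 add0r add_row_mx.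
  rewrite -row_mx0 => /eq_row_mx[_ eb].
  move: (congr1 (mulmx^~ eB) eb); rewrite mulmxDl -mulmxA dB mulmx0 add0r.
  rewrite mul_mx_scalar -scalemxAl mul0mx => /mx11E; rewrite mxE => /varI e.
  exact/mx11E.
rewrite mul_row_block mulmx0 add0r -row_mx0 => /eq_row_mx[e ec].
apply: cone_step => //; apply: (proj1 (mr_acyclic RB (i := i) _)).
by apply/eqP; rewrite -oppr_eq0 -mulmxN ec.
Qed.

(** A monomial of x A + B outside B is x times a monomial of A. *)
Lemma cone_image p :
  mon_ideal UC p <-> exists v : 'rV_(crk cone 0), p = (v *m cone_aug) 0 0.
Proof.
split=> [hp|[v ->]]; last first.
  rewrite -[v]hsubmxK; set a := lsubmx v; set b := rsubmx v.
  rewrite /cone_aug mul_row_col -scalemxAr mxE [X in X + _]mxE.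
  apply: mon_idealD => u.
    rewrite mulrC (perm_mem (msuppMX _ _)) => /mapP[w hw ->].
    rewrite UCE mnmDE mnm1E eqxx xA; apply/orP; left => /=.
    by apply: (proj2 (mr_image RA _)) hw; exists a.
  move=> hu; rewrite UCE; apply/orP; right.
  by apply: (proj2 (mr_image RB _)) hu; exists b.
pose p2 := mfilter (predC UB) p.
have [b eb] : exists b : 'rV_(crk B 0), mfilter UB p = (b *m eB) 0 0.
  by apply: (proj1 (mr_image RB _)) => u; rewrite msupp_mfilter => /andP[].
have h2 u : u \in msupp p2 -> (0 < u x)%N && UA u.
  rewrite msupp_mfilter => /andP[/= /negPf nB /hp].
  by rewrite UCE nB orbF.
pose q := \sum_(u <- msupp p2) p2@_u *: 'X_[u - U_(x)].
have sub1 (u : mon) : (0 < u x)%N -> (U_(x) + (u - U_(x)))%MM = u.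
  move=> ux; apply/mnmP => y; rewrite mnmDE mnmBE mnm1E.
  by case: eqP => [<-|_]; lia.
have [a ea] : exists a : 'rV_(crk A 0), q = (a *m eA) 0 0.
  apply: (proj1 (mr_image RA _)) => w.
  rewrite /q => /msupp_sum_le /flattenP[s /mapP[u]].
  rewrite filter_predT => /h2 /andP[ux Uu] -> /msuppZ_le.
  by rewrite msuppX inE => /eqP ->; rewrite -xA sub1.
have eq : p2 = X * q.
  rewrite [LHS]mpolyE /q mulr_sumr [LHS]big_seq [RHS]big_seq.
  apply: eq_bigr => u /h2 /andP[ux _].
  by rewrite -scalerAr -mpolyXD sub1.
exists (row_mx a b); rewrite /cone_aug mul_row_col -scalemxAr mxE [X in X + _]mxE.
rewrite -ea -eq -eb; apply/mpolyP => u; rewrite mcoeffD !mcoeff_mfilter /=.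
by case: (UB u); rewrite ?add0r ?addr0.
Qed.

Lemma cone_degU i a : UC (cdeg cone i 0 a).
Proof.
have hA l (c : 'I_(crk A l)) : UC (shift x (cdeg A l) 0 c).
  by rewrite UCE mxE xA (mr_deg RA) mnmDE mnm1E eqxx.
have hB l (c : 'I_(crk B l)) : UC (cdeg B l 0 c).
  by rewrite UCE (mr_deg RB) orbT.
have hxB l (c : 'I_(crk B l)) : UC (shift x (cdeg B l) 0 c).
  by rewrite UCE mxE xB (mr_deg RB) orbT.
move: a; case: i => [|i] /=.
  exact: (row_mx_ind (hA 0%N) (hB 0%N)).
exact: (row_mx_ind (row_mx_ind (hA i.+1) (hB i.+1)) (hxB i)).
Qed.

Lemma cone_resolution : @minimal_resolution UC cone cone_aug.
Proof.
split.
- exact: graded_cone.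
- exact: graded_cone_aug.
- exact: cone_min.
- exact: cone_image.
- exact: cone_exact0.
- exact: cone_acyclic.
- exact: cone_degU.
Qed.

End Cone.
End MappingCone.

(** * The ring of power series in x and t *)

Section SeriesRing.

Definition trunc (N : nat) (f : series2) : {poly {poly int}} :=
  \poly_(i < N) \poly_(j < N) f i j.

Lemma trunc_coef N f i j : (i < N)%N -> (j < N)%N -> ((trunc N f)`_i)`_j = f i j.
Proof. by move=> hi hj; rewrite !(coef_poly, hi, hj). Qed.

(** Truncations reduce the ring axioms for the Cauchy product to those of
    bivariate polynomials. *)
Lemma mul2_coef N f g i j : (i < N)%N -> (j < N)%N ->
  mul2 f g i j = ((trunc N f * trunc N g)`_i)`_j.
Proof.
move=> hi hj; rewrite coefM coef_sum; apply: eq_bigr => a _.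
rewrite coefM; apply: eq_bigr => b _.
by rewrite !trunc_coef //; move: (ltn_ord a) (ltn_ord b); lia.
Qed.

Lemma series2P (f g : series2) : (forall i j, f i j = g i j) -> f = g.
Proof. by move=> h; apply/funext => i; apply/funext. Qed.

Definition zero2 : series2 := fun _ _ => 0.
Definition opp2 (f : series2) : series2 := fun i j => - f i j.

Fact add2A : associative add2.
Proof. by move=> f g h; apply: series2P => i j; rewrite /add2 addrA. Qed.
Fact add2C : commutative add2.
Proof. by move=> f g; apply: series2P => i j; rewrite /add2 addrC. Qed.
Fact add02 : left_id zero2 add2.
Proof. by move=> f; apply: series2P => i j; rewrite /add2 add0r. Qed.
Fact addN2 : left_inverse zero2 opp2 add2.
Proof. by move=> f; apply: series2P => i j; rewrite /add2 addNr. Qed.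

HB.instance Definition _ := Choice.copy series2 (nat -> nat -> int).
HB.instance Definition _ := GRing.isZmodule.Build series2 add2A add2C add02 addN2.

Fact mul2A : associative mul2.
Proof.
move=> f g h; apply: series2P => i j; pose N := (i + j).+1.
transitivity (((trunc N f * trunc N g * trunc N h)`_i)`_j).
  rewrite -mulrA coefM coef_sum; apply: eq_bigr => a _.
  rewrite [RHS]coefM; apply: eq_bigr => b _.
  by rewrite trunc_coef -?mul2_coef // /N; move: (ltn_ord a) (ltn_ord b); lia.
rewrite coefM coef_sum; apply: eq_bigr => a _.
rewrite [LHS]coefM; apply: eq_bigr => b _.
by rewrite trunc_coef -?mul2_coef // /N; move: (ltn_ord a) (ltn_ord b); lia.
Qed.

Fact mul2C : commutative mul2.
Proof.
move=> f g; apply: series2P => i j; pose N := (i + j).+1.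
have [iN jN] : (i < N)%N /\ (j < N)%N by rewrite /N; lia.
by rewrite (mul2_coef f g iN jN) (mul2_coef g f iN jN) mulrC.
Qed.

Lemma mono2_mul a b f i j :
  mul2 (mono2 a b) f i j =
  if (a <= i)%N && (b <= j)%N then f (i - a)%N (j - b)%N else 0.
Proof.
rewrite /mul2 /mono2; case: (leqP a i) => ha /=; last first.
  by rewrite big1 // => c _; rewrite big1 // => e _; case: eqP => [ec|]; rewrite ?mul0r //; move: (ltn_ord c); lia.
rewrite (bigD1 (inord a)) //= inordK ?ltnS // eqxx /=.
rewrite [X in _ + X]big1 => [|c nc]; last first.
  rewrite big1 // => e _; case: eqP => [ec|]; rewrite ?mul0r //.
  by rewrite -ec inord_val eqxx in nc.
rewrite addr0; case: (leqP b j) => hb; last first.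
  by rewrite big1 // => e _; case: eqP => [ec|]; rewrite ?mul0r //; move: (ltn_ord e); lia.
rewrite (bigD1 (inord b)) //= inordK ?ltnS // eqxx mul1r.
rewrite big1 ?addr0 // => c nc; case: eqP => [ec|]; rewrite ?mul0r //.
by rewrite -ec inord_val eqxx in nc.
Qed.

Fact mul12 : left_id one2 mul2.
Proof. by move=> f; apply: series2P => i j; rewrite mono2_mul !subn0. Qed.

Fact mul2DL : left_distributive mul2 add2.
Proof.
move=> f g h; apply: series2P => i j; rewrite /add2 /mul2 -big_split.
apply: eq_bigr => a _; rewrite -big_split; apply: eq_bigr => b _.
by rewrite mulrDl.
Qed.

Fact one2_neq0 : one2 != zero2.
Proof. by apply/eqP => /(congr1 (fun f : series2 => f 0%N 0%N)). Qed.

HB.instance Definition _ :=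
  GRing.Zmodule_isComNzRing.Build series2 mul2A mul2C mul12 mul2DL one2_neq0.

End SeriesRing.

Notation t2 := (mono2 0 1 : series2).
Notation x2 := (mono2 1 0 : series2).

Lemma exp2E (f : series2) m : exp2 f m = f ^+ m.
Proof. by elim: m => [|m IH] //; rewrite exprS -IH. Qed.

Lemma mono2M a b c e : (mono2 a b : series2) * mono2 c e = mono2 (a + c) (b + e).
Proof.
apply: series2P => i j; rewrite [LHS]mono2_mul /mono2.
have -> : ((i == a + c) && (j == b + e) =
  ((a <= i) && (b <= j)) && ((i - a == c) && (j - b == e)))%N by lia.
by case: ifP.
Qed.

Lemma mono2X m : mono2 m 0 = x2 ^+ m.
Proof.
by elim: m => [|m IH]; rewrite ?expr0 // exprS -IH mono2M add1n.
Qed.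

Lemma mono2T m : mono2 0 m = t2 ^+ m.
Proof.
by elim: m => [|m IH]; rewrite ?expr0 // exprS -IH mono2M add1n.
Qed.

Lemma x2M_S f i j : (x2 * f) i.+1 j = f i j.
Proof. by rewrite [LHS]mono2_mul /= subn1 subn0. Qed.

Lemma x2M_0 f j : (x2 * f) 0%N j = 0.
Proof. by rewrite [LHS]mono2_mul. Qed.

Lemma x2I (f g : series2) m : x2 ^+ m * f = x2 ^+ m * g -> f = g.
Proof.
elim: m => [|m IH] in f g *; first by rewrite !mul1r.
rewrite exprSr -!mulrA => /IH e; apply: series2P => i j.
by rewrite -[LHS]x2M_S e x2M_S.
Qed.

Lemma series_coefD (f g : series2) i j : (f + g) i j = f i j + g i j.
Proof. by []. Qed.

Lemma mul2E (f g : series2) : mul2 f g = f * g.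
Proof. by []. Qed.

Lemma series_coefM (f g : series2) i j : (f * g) i j =
  \sum_(a < i.+1) \sum_(b < j.+1) f a b * g (i - a)%N (j - b)%N.
Proof. by []. Qed.

Lemma series_coef00M (f g : series2) : (f * g) 0%N 0%N = f 0%N 0%N * g 0%N 0%N.
Proof. by rewrite series_coefM !big_ord1. Qed.


(** * The fixed point equation and its solution *)

(** For w the series of the paths below a node, this is the series of the paths
    through the edge that leads to it. *)
Definition branch (w : series2) : series2 := t2 + w + t2 * x2 * w.

Definition level_up (k : nat) (w : series2) : series2 := branch w ^+ k.

Definition wseq (k n : nat) : series2 := iter n (level_up k) 0.

Definition agree (N : nat) (f g : series2) :=
  forall i j, (i + j < N)%N -> f i j = g i j.

Lemma agree_mul N f f' g g' :
  agree N f f' -> agree N g g' -> agree N (f * g) (f' * g').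
Proof.
move=> hf hg i j hij; rewrite !series_coefM; apply: eq_bigr => a _; apply: eq_bigr => b _.
move: (ltn_ord a) (ltn_ord b) => la lb.
by rewrite hf ?hg //; lia.
Qed.

Lemma agree_add N f f' g g' :
  agree N f f' -> agree N g g' -> agree N (f + g) (f' + g').
Proof. by move=> hf hg i j h; rewrite !series_coefD hf ?hg. Qed.

Lemma agree_exp N f f' m : agree N f f' -> agree N (f ^+ m) (f' ^+ m).
Proof. by move=> h; elim: m => [|m IH] //; rewrite !exprS; apply: agree_mul. Qed.

(** Without constant terms, a coefficient of the product of total degree N only
    involves coefficients of the factors of degree less than N. *)
Lemma agree_mul_gain N (f f' g g' : series2) :
  f 0%N 0%N = 0 -> g 0%N 0%N = 0 -> f' 0%N 0%N = 0 -> g' 0%N 0%N = 0 ->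
  agree N f f' -> agree N g g' -> agree N.+1 (f * g) (f' * g').
Proof.
move=> f0 g0 f'0 g'0 hf hg i j hij; rewrite !series_coefM.
apply: eq_bigr => a _; apply: eq_bigr => b _.
case: (posnP (a + b)) => [ab0|abp].
  have -> : (a : nat) = 0%N by lia.
  have -> : (b : nat) = 0%N by lia.
  by rewrite f0 f'0 !mul0r.
move: (ltn_ord a) (ltn_ord b) => la lb.
case: (posnP ((i - a) + (j - b))) => [ab0|ab'].
  have -> : (i - a = 0)%N by lia.
  have -> : (j - b = 0)%N by lia.
  by rewrite g0 g'0 !mulr0.
by rewrite hf ?hg //; lia.
Qed.

Lemma branch00 w : w 0%N 0%N = 0 -> branch w 0%N 0%N = 0.
Proof.
move=> w0; rewrite /branch !series_coefD w0 series_coef00M w0 mulr0 !addr0.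
by rewrite /mono2.
Qed.

Section Limit.
Variable k : nat.
Hypothesis hk : (2 <= k)%N.

Lemma exp00 (u : series2) m : u 0%N 0%N = 0 -> (0 < m)%N -> (u ^+ m) 0%N 0%N = 0.
Proof. by case: m => // m u0 _; rewrite exprS series_coef00M u0 mul0r. Qed.

Lemma level_up00 w : w 0%N 0%N = 0 -> level_up k w 0%N 0%N = 0.
Proof. by move=> w0; apply: exp00; [exact: branch00|lia]. Qed.

(** This is where k >= 2 matters: a k-th power is a product of two series without
    constant term, hence the equation is a contraction. *)
Lemma agree_level_up N w w' : w 0%N 0%N = 0 -> w' 0%N 0%N = 0 ->
  agree N w w' -> agree N.+1 (level_up k w) (level_up k w').
Proof.
move=> w0 w'0 h; rewrite /level_up (_ : k = k.-1.+1) ?exprS; last by lia.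
have hb : agree N (branch w) (branch w').
  by do !apply: agree_add => //; apply: agree_mul.
apply: agree_mul_gain => //; try exact: branch00.
- by apply: exp00; [exact: branch00|lia].
- by apply: exp00; [exact: branch00|lia].
exact: agree_exp.
Qed.

Lemma wseq00 n : wseq k n 0%N 0%N = 0.
Proof. by elim: n => //= n IH; apply: level_up00. Qed.

Lemma agree_wseqS n : agree n (wseq k n) (wseq k n.+1).
Proof.
elim: n => // n IH; apply: agree_level_up IH; exact: wseq00.
Qed.

Lemma wseq_stable i j m n : (i + j < m)%N -> (m <= n)%N ->
  wseq k n i j = wseq k m i j.
Proof.
move=> h /subnKC <-; elim: (n - m)%N => [|l IH]; first by rewrite addn0.
by rewrite addnS -agree_wseqS //; lia.
Qed.

Definition wlim : series2 := fun i j => wseq k (i + j).+1 i j.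

Lemma agree_wlim n : agree n (wseq k n) wlim.
Proof. by move=> i j h; rewrite /wlim (@wseq_stable i j (i + j).+1). Qed.

Lemma wlim00 : wlim 0%N 0%N = 0. Proof. exact: wseq00. Qed.

Lemma wlim_fix : level_up k wlim = wlim.
Proof.
apply: series2P => i j; pose N := (i + j).+1.
have h := agree_level_up (wseq00 N) wlim00 (@agree_wlim N).
transitivity (wseq k N.+1 i j); first by rewrite -h // /N; lia.
by apply: (@agree_wlim N.+1); rewrite /N; lia.
Qed.

Lemma wlim_unique w : w 0%N 0%N = 0 -> w = level_up k w -> w = wlim.
Proof.
move=> w0 e; apply: series2P => i j.
suff h N : agree N w wlim by apply: (h (i + j).+1).
elim: N => // N IH; rewrite e -wlim_fix.
exact: (agree_level_up w0 wlim00 IH).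
Qed.

(** With G = x w one has (1 + t x)(1 + G) - 1 = x (t + w + t x w), and x^k cancels
    from the equation. *)
Lemma limit_seriesP G : is_limit_series k G <-> G = x2 * wlim.
Proof.
have key w : sub2 (mul2 (add2 one2 (mono2 1 1)) (add2 one2 (x2 * w))) one2 =
             x2 * branch w.
  have -> : mono2 1 1 = t2 * x2 by rewrite mono2M.
  change ((1 + t2 * x2) * (1 + x2 * w) - 1 = x2 * branch w).
  by rewrite /branch; ring.
have key2 w : mul2 (mono2 k.-1 0) (x2 * w) = x2 ^+ k * w.
  rewrite mul2E mono2X mulrA -exprSr prednK //; lia.
split=> [[[w w0 ->]]|->].
  rewrite (mul2E x2 w) key exp2E exprMn key2 => /x2I e.
  by rewrite -(wlim_unique w0 e).
split; first by exists wlim => //; exact: wlim00.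
by rewrite key exp2E exprMn key2 -/(level_up k wlim) wlim_fix.
Qed.

Lemma betti_limitE i j : betti_limit k i j = (x2 * wlim) i j.
Proof.
apply: xget_unique.
  by exists (x2 * wlim) => //; apply/limit_seriesP.
by move=> _ [G /limit_seriesP -> ->].
Qed.


Definition le2 (f g : series2) := forall i j, 0 <= f i j <= g i j.

Lemma le2M f f' g g' : le2 f f' -> le2 g g' -> le2 (f * g) (f' * g').
Proof.
move=> hf hg i j; rewrite !series_coefM; apply/andP; split.
  apply: sumr_ge0 => a _; apply: sumr_ge0 => b _.
  have /andP[? _] := hf a b; have /andP[? _] := hg (i - a)%N (j - b)%N.
  exact: mulr_ge0.
apply: ler_sum => a _; apply: ler_sum => b _.
have /andP[? ?] := hf a b; have /andP[? ?] := hg (i - a)%N (j - b)%N.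
exact: ler_pM.
Qed.

Lemma le2D f f' g g' : le2 f f' -> le2 g g' -> le2 (f + g) (f' + g').
Proof.
move=> hf hg i j; rewrite !series_coefD.
have /andP[? ?] := hf i j; have /andP[? ?] := hg i j.
by rewrite addr_ge0 //= lerD.
Qed.

Lemma le2_mono a b : le2 (mono2 a b) (mono2 a b).
Proof. by move=> i j; rewrite lexx andbT ler0n. Qed.

Lemma le2X f g m : le2 f g -> le2 (f ^+ m) (g ^+ m).
Proof.
move=> h; elim: m => [|m IH]; first exact: le2_mono.
by rewrite !exprS; apply: le2M.
Qed.

Lemma le2_branch f g : le2 f g -> le2 (branch f) (branch g).
Proof.
move=> h; do !apply: le2D => //; try exact: le2_mono.
by do !apply: le2M => //; exact: le2_mono.
Qed.

Lemma le2_wseqS n : le2 (wseq k n) (wseq k n.+1).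
Proof.
elim: n => [|n IH]; last exact/le2X/le2_branch.
have h0 : le2 0 0 by [].
have h := le2X k (le2_branch h0).
move=> i j; rewrite lexx /=.
by have /andP[] := h i j.
Qed.

Lemma wseq_mono m n i j : (m <= n)%N -> wseq k m i j <= wseq k n i j.
Proof.
move=> /subnKC <-; elim: (n - m)%N => [|l IH]; first by rewrite addn0.
apply: le_trans IH _; rewrite addnS.
by have /andP[] := le2_wseqS (m + l) i j.
Qed.

Lemma wseq_le_wlim n i j : wseq k n i j <= wlim i j.
Proof.
have <- := @agree_wlim (maxn n (i + j).+1) i j; last by rewrite leq_max ltnSn orbT.
exact/wseq_mono/leq_maxl.
Qed.

Lemma le2_wlim : le2 wlim wlim.
Proof.
move=> i j; rewrite lexx andbT.
by have /andP[] := le2_wseqS (i + j).+1 i j.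
Qed.

Lemma le2_addr f g h : le2 f f -> le2 g h -> le2 f (f + h).
Proof.
move=> hf hg; rewrite -[X in le2 X]addr0; apply: le2D => //.
move=> i j; have /andP[h1 h2] := hg i j; rewrite lexx; exact: le_trans h2.
Qed.

(** One of the k factors t + w + t x w is kept and the others are bounded below
    by t. *)
Lemma wlim_ge : le2 (t2 ^+ k.-1 * branch wlim) wlim.
Proof.
have hb := le2_branch le2_wlim.
have {2}<- : branch wlim ^+ k.-1 * branch wlim = wlim.
  by rewrite -exprSr prednK; [exact: wlim_fix|lia].
apply: le2M hb; apply: le2X; rewrite /branch -addrA.
apply: le2_addr (le2_mono _ _) _; last first.
  apply: le2D le2_wlim _.
  by do !apply: le2M => //; [exact: le2_mono|exact: le2_mono|exact: le2_wlim].
Qed.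

Lemma branch_coef w i j : branch w i j =
  t2 i j + w i j + (if (0 < i)%N && (0 < j)%N then w i.-1 j.-1 else 0).
Proof. by rewrite /branch mono2M !series_coefD [X in _ + X]mono2_mul !subn1. Qed.

Lemma wlim_branch i j : branch wlim i j <= wlim i (j + k.-1)%N.
Proof.
have /andP[_] := wlim_ge i (j + k.-1); apply: le_trans.
by rewrite -mono2T [X in _ <= X]mono2_mul leq_addl /= addnK subn0.
Qed.

Lemma wlim_col i j : wlim i j <= wlim i (j + k.-1)%N.
Proof.
apply: le_trans (wlim_branch i j); rewrite branch_coef.
rewrite addrAC lerDr addr_ge0 ?ler0n //; case: ifP => // _.
by have /andP[] := le2_wlim i.-1 j.-1.
Qed.

Lemma wlim_row i j : wlim i j <= wlim i.+1 (j + k)%N.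
Proof.
rewrite (_ : j + k = j.+1 + k.-1)%N; last by lia.
apply: le_trans (wlim_branch i.+1 j.+1); rewrite branch_coef /=.
by rewrite lerDr addr_ge0 ?ler0n //; have /andP[] := le2_wlim i.+1 j.+1.
Qed.

(** Starting from the term t^k of w, [wlim_row] reaches every i and [wlim_col]
    moves a positive coefficient k - 1 places further. *)
Lemma wlim_unbounded i J : exists2 j, (J <= j)%N & 0 < wlim i j.
Proof.
elim: J => [|J [j hj pj]].
  elim: i => [|i [j _ pj]]; last first.
    by exists (j + k)%N => //; apply: lt_le_trans pj (wlim_row i j).
  exists (1 + k.-1)%N => //; apply: lt_le_trans (wlim_branch 0 1).
  rewrite branch_coef /= addr0 ltr_pwDl //.
  by have /andP[] := le2_wlim 0 1.
exists (j + k.-1)%N; first by lia.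
exact: lt_le_trans pj (wlim_col i j).
Qed.

End Limit.

(** * Ideals with a minimal resolution of known generating series *)

Section Resolvable.
Variables (K : fieldType) (d : nat).
Notation S := {mpoly K[d]}.
Notation mon := 'X_{1..d}.

Definition degcount n (al : 'rV[mon]_n) (j : nat) : int :=
  \sum_a (mdeg (al 0 a) == j)%:R.

Lemma degcount_row_mx m n (al : 'rV[mon]_m) (be : 'rV[mon]_n) j :
  degcount (row_mx al be) j = degcount al j + degcount be j.
Proof.
rewrite /degcount big_split_ord /=.
by congr (_ + _); apply: eq_bigr => a _; rewrite ?row_mxEl ?row_mxEr.
Qed.

Lemma degcount_shift n x (al : 'rV[mon]_n) j :
  degcount (shift x al) j = if (0 < j)%N then degcount al j.-1 else 0.
Proof.
rewrite /degcount; case: j => [|j] /=.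
  by rewrite big1 // => a _; rewrite mxE /mon_act mdegD mdeg1.
by apply: eq_bigr => a _; rewrite mxE /mon_act mdegD mdeg1.
Qed.

Definition gen_series (C : chain K d mon) : series2 :=
  fun i j => degcount (cdeg C i) j.

Lemma t2M_coef (g : series2) i j :
  (t2 * g) i j = if (0 < j)%N then g i j.-1 else 0.
Proof. by rewrite -mul2E mono2_mul /= subn0 subn1. Qed.

Lemma gen_series_cone x (A B : chain K d mon) (f : forall i, 'M[S]_(crk B i, crk A i)) :
  gen_series (cone x f) = t2 * gen_series A + (1 + t2 * x2) * gen_series B.
Proof.
apply: series2P => i j; rewrite mulrDl mul1r -mulrA !series_coefD !t2M_coef.
case: i => [|i]; rewrite /gen_series /= !(degcount_row_mx, degcount_shift).
  by rewrite x2M_0 if_same addr0.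
by rewrite x2M_S addrA.
Qed.

(** The set W contains the variables that the ideal and its multidegrees involve;
    P is the generating series of the degrees of the resolution. *)
Definition resolvable (U : pred mon) (W : pred 'I_d) (P : series2) : Prop :=
  (forall u v : mon, (forall y, W y -> u y = v y) -> U u = U v) /\
  exists (C : chain K d mon) (ep : 'cV[S]_(crk C 0)),
    [/\ minimal_resolution U ep,
        forall i a y, ~~ W y -> cdeg C i 0 a y = 0%N &
        gen_series C = P].

Lemma resolvable_widen U U' (W W' : pred 'I_d) P P' :
  (forall u, U' u = U u) -> (forall y, W y -> W' y) -> P' = P ->
  resolvable U W P -> resolvable U' W' P'.
Proof.
move=> eU sW -> [ind [C [ep [R hW hP]]]]; split.
  by move=> u v e; rewrite !eU; apply: ind => y /sW; apply: e.
exists C, ep; split=> //.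
  case: R => h1 h2 h3 h4 h5 h6 h7; split=> //; last by move=> i a; rewrite eU.
  move=> p; rewrite -h4 /mon_ideal.
  by split=> h u /h; rewrite eU.
by move=> i a y ny; apply: hW; apply: contra ny => /sW.
Qed.

Definition point_chain : chain K d mon :=
  @Chain K d mon (fun i => if i is 0 then 1%N else 0%N)
    (fun i => const_mx 0%MM) (fun i => 0).

Lemma resolvable_unit : resolvable xpredT pred0 1.
Proof.
split=> //; exists point_chain, 1%:M; split.
- split.
  + by move=> i a b u; rewrite mxE msupp0.
  + move=> a b u; rewrite (ord1 b) (ord1 a) !mxE eqxx msupp1 inE => /eqP ->.
    exact: mon_act0.
  + by move=> i; rewrite reduce0.
  + by move=> p; split=> // _; exists p%:M; rewrite mulmx1 mxE.
  + move=> v; split=> [|[u ->]]; last by rewrite mulmx0 mul0mx.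
    by rewrite mulmx1 => ->; exists 0; rewrite mul0mx.
  + move=> i v; split=> [_|_]; last by rewrite mulmx0.
    by exists 0; rewrite mul0mx; apply/matrixP => a [].
  + by [].
- by move=> i a y _; rewrite mxE mnm0E.
apply: series2P => -[|i] j; rewrite /gen_series /degcount /=; last by rewrite big_ord0.
by rewrite big_ord1 mxE mdeg0 eq_sym.
Qed.

Lemma resolvable_zero W : resolvable xpred0 W 0.
Proof.
split=> //.
exists (@Chain K d mon (fun=> 0%N) (fun=> const_mx 0%MM) (fun=> 0)), 0; split.
- split.
  + by move=> i a b u; rewrite mxE msupp0.
  + by move=> a b u; rewrite mxE msupp0.
  + by move=> i; rewrite reduce0.
  + move=> p; split=> [hp|[v ->]]; last by rewrite mulmx0 mxE => u; rewrite msupp0.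
    exists 0; rewrite mul0mx mxE; apply: msuppnil0.
    move: hp; rewrite /mon_ideal; case: (msupp p) => // u s /(_ u).
    by rewrite inE eqxx => /(_ isT).
  + move=> v; split=> _; last by rewrite mulmx0.
    by exists 0; rewrite mul0mx; apply/matrixP => a [].
  + move=> i v; split=> _; last by rewrite mulmx0.
    by exists 0; rewrite mul0mx; apply/matrixP => a [].
  + by move=> i [].
- by move=> i [].
by apply: series2P => i j; rewrite /gen_series /degcount big_ord0.
Qed.

(** A constant entry of a multigraded lift would link generators of equal
    multidegree. *)
Lemma minimal_lift UA UB (A B : chain K d mon) eA eB :
  @minimal_resolution _ _ UA A eA -> @minimal_resolution _ _ UB B eB ->
  (forall u, UB u -> UA u) ->
  (forall i a b, cdeg B i 0 a <> cdeg A i 0 b) ->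
  exists f : forall i, 'M[S]_(crk B i, crk A i),
    [/\ graded_map (@mon_act d) f, chain_map f, f 0%N *m eA = eB &
        forall i, reduce (f i) = 0].
Proof.
move=> RA RB sBA ne.
have [|f0 hf0 ef0] := graded_factor (mon_actD (d := d)) (mr_aug RB) (mr_aug RA).
  move=> a; have [|v ev] := proj1 (mr_image RA (eB a 0)).
    move=> u hu; apply: sBA; apply: (proj2 (mr_image RB (eB a 0))) hu.
    by exists (delta_mx 0 a); rewrite -rowE mxE.
  by exists v; apply/matrixP => i j; rewrite !ord1 -ev mxE.
have [|Y _ eY] := exact_factor (mon_actD (d := d)) (mr_exact0 RA)
  (graded_mul (mon_actD (d := d)) (mr_graded RB (i := 0)) hf0) (mr_graded RA (i := 0)).
  by rewrite -mulmxA -ef0; apply/exact_comp/(mr_exact0 RB).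
have [f [hf cf fE]] := chain_lift (mon_actD (d := d)) (mr_graded RB) (mr_graded RA)
  (fun i => exact_comp (mr_acyclic RB (i := i))) (mr_acyclic RA) hf0
  (ex_intro _ Y eY).
exists f; split=> //; first by rewrite fE.
move=> i; apply/matrixP => a b; rewrite !mxE; apply: memN_msupp_eq0.
apply/negP => /hf e; apply: (ne i a b); by rewrite -e mon_act0.
Qed.

(** Multidegrees of the resolution of B involve a variable outside WA, those of A
    do not, so that [minimal_lift] applies. *)
Lemma resolvable_split x (UA UB UC : pred mon) (WA WB WC : pred 'I_d) PA PB :
  resolvable UA WA PA -> resolvable UB WB PB ->
  ~~ WA x -> ~~ WB x -> (forall u, UB u -> UA u) ->
  (forall u : mon, UC u = (0 < u x)%N && UA u || UB u) ->
  (forall m : mon, UB m -> exists2 y, ~~ WA y & m y <> 0%N) ->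
  (forall y, WC y = [|| y == x, WA y | WB y]) ->
  resolvable UC WC (t2 * PA + (1 + t2 * x2) * PB).
Proof.
move=> [indA [A [eA [RA hA <-]]]] [indB [B [eB [RB hB <-]]]] xA xB sBA UCE sep WCE.
have fix_off (W : pred 'I_d) (u : mon) y : ~~ W x -> W y -> (U_(x) + u)%MM y = u y.
  move=> nx Wy; rewrite mnmDE mnm1E; case: eqP => // e.
  by rewrite e Wy in nx.
split.
  move=> u v e; rewrite !UCE (indA u v) ?(indB u v) ?(e x) ?WCE ?eqxx //.
    by move=> y Wy; apply: e; rewrite WCE Wy !orbT.
  by move=> y Wy; apply: e; rewrite WCE Wy !orbT.
have [|f [hf cf f0 fmin]] := minimal_lift RA RB sBA.
  move=> i a b e; have [y ny] := sep _ (mr_deg RB a).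
  by rewrite e hA.
exists (cone x f), (cone_aug x eA eB); split.
- apply: (cone_resolution RA RB) => //.
  + by move=> u; apply: indA => y; apply: fix_off.
  + by move=> u; apply: indB => y; apply: fix_off.
- move=> i a y; rewrite WCE !negb_or => /and3P[yx yA yB].
  have hx n (al : 'rV[mon]_n) :
      (forall c, al 0 c y = 0%N) -> forall c, shift x al 0 c y = 0%N.
    by move=> h c; rewrite mxE /mon_act mnmDE h mnm1E eq_sym (negPf yx).
  have hAy l (c : 'I_(crk A l)) : cdeg A l 0 c y == 0%N by rewrite hA.
  have hBy l (c : 'I_(crk B l)) : cdeg B l 0 c y == 0%N by rewrite hB.
  have hAx l (c : 'I_(crk A l)) : shift x (cdeg A l) 0 c y == 0%N.
    by apply/eqP/hx => e; apply/eqP/hAy.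
  have hBx l (c : 'I_(crk B l)) : shift x (cdeg B l) 0 c y == 0%N.
    by apply/eqP/hx => e; apply/eqP/hBy.
  apply/eqP; move: a; case: i => [|i] /=.
    exact: (row_mx_ind (U := fun m : mon => m y == 0%N) (hAx 0%N) (hBy 0%N)).
  exact: (row_mx_ind (U := fun m : mon => m y == 0%N)
    (row_mx_ind (U := fun m : mon => m y == 0%N) (hAx i.+1) (hBy i.+1)) (hBx i)).
exact: gen_series_cone.
Qed.

End Resolvable.

(** * The cut ideal of the complete tree *)

Section Tree.
Variables (K : fieldType) (k n : nat).
Hypothesis hk : (2 <= k)%N.
Notation d := #|edge k n|.
Notation mon := 'X_{1..d}.

Definition word (y : 'I_d) : seq 'I_k := tagged (enum_val y).

Lemma word_inj : injective word.
Proof.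
move=> y z; rewrite /word => e; apply: enum_val_inj.
case: (enum_val y) (enum_val z) e => [m s] [m' s'] /= e.
have em : m = m'.
  by apply: val_inj; apply: succn_inj; rewrite -(size_tuple s) e size_tuple.
by move: s' e; rewrite -em => s' /val_inj ->.
Qed.

Lemma word_surj s : (0 < size s <= n)%N -> exists y, word y = s.
Proof.
case: s => // c s /= hs.
exists (enum_rank (existT (fun m : 'I_n => m.+1.-tuple 'I_k) (Ordinal hs)
  (in_tuple (c :: s)))).
by rewrite /word enum_rankK.
Qed.

Definition hit (s : seq 'I_k) (u : mon) : bool :=
  [exists y, (word y == s) && (0 < u y)%N].

Lemma hitE y u : hit (word y) u = (0 < u y)%N.
Proof.
apply/existsP/idP => [[z /andP[/eqP /word_inj ->]] //|h].
by exists y; rewrite eqxx.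
Qed.

(** The monomial u cuts all the paths going h levels down from the node w. *)
Fixpoint cut_below (h : nat) (w : seq 'I_k) (u : mon) : bool :=
  if h is h'.+1 then
    [forall c : 'I_k, hit (rcons w c) u || cut_below h' (rcons w c) u]
  else false.

Definition below (w s : seq 'I_k) : bool := prefix w s && (s != w).

Lemma prefix_rcons_below w c s : prefix (rcons w c) s -> below w s.
Proof.
move=> /prefixP[r ->]; rewrite /below cat_rcons prefix_prefix /=.
by apply/eqP => /(congr1 size); rewrite size_cat /=; lia.
Qed.

Lemma below_rcons w c s : below (rcons w c) s -> below w s.
Proof. by case/andP => /prefix_rcons_below. Qed.

Lemma cut_below_supp h w (m : mon) : cut_below h w m ->
  exists2 y, below w (word y) & m y <> 0%N.
Proof.
have c0 : 'I_k by exact: Ordinal (ltnW hk).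
elim: h w => //= h IH w /forallP /(_ c0) /orP[|/IH[y yw ny]].
  case/existsP => y /andP[/eqP yw my]; exists y; last by case: (m y) my.
  by apply: (@prefix_rcons_below _ c0); rewrite yw prefix_refl.
by exists y => //; apply: below_rcons yw.
Qed.

(** The induction on h adds the children of w one at a time, each by a vertex
    splitting along the edge above it; by induction the paths below this child
    contribute the factor wseq k h.  A leaf contributes the zero ideal,
    whence the initial value 0. *)
Lemma resolvable_cut_below h w (U : pred mon) (W : pred 'I_d) P :
  (size w + h = n)%N -> resolvable K U W P ->
  (forall y, W y -> ~~ below w (word y)) ->
  resolvable K (fun u => cut_below h w u && U u)
    (fun y => W y || below w (word y)) (wseq k h * P).
Proof.
elim: h w U W P => [|h IH] w U W P sz RU off.
  rewrite mul0r.
  by apply: (resolvable_widen (U := xpred0) (W := xpred0) _ _ erefl) => //;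
    apply: resolvable_zero.
(* State after the children in cs have been added. *)
pose UU (cs : seq 'I_k) (u : mon) :=
  all (fun c => hit (rcons w c) u || cut_below h (rcons w c) u) cs && U u.
pose WW (cs : seq 'I_k) (y : 'I_d) :=
  W y || has (fun c => prefix (rcons w c) (word y)) cs.
have main cs : uniq cs ->
    resolvable K (UU cs) (WW cs) (branch (wseq k h) ^+ size cs * P).
  elim: cs => [_|c cs IHcs /= /andP[ncs ucs]].
    by apply: resolvable_widen RU => // [y|]; rewrite /WW /= ?orbF ?mul1r //.
  have RA := IHcs ucs.
  have szc : (size (rcons w c) + h = n)%N by rewrite size_rcons; lia.
  have offA y : WW cs y -> ~~ prefix (rcons w c) (word y).
    case/orP => [/off|/hasP[c' c'cs pc']].
      by apply: contra => /prefix_rcons_below.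
    apply/negP => pc; have ec : rcons w c = rcons w c'.
      have := pc; have := pc'; rewrite !prefixE !size_rcons.
      by move=> /eqP <- /eqP <-.
    by case/rcons_inj: ec => ec; rewrite ec c'cs in ncs.
  have RB := IH (rcons w c) _ _ _ szc RA.
  have {}RB := RB (fun y Wy => contra (fun b => proj1 (andP b)) (offA y Wy)).
  have [x ex] : exists x, word x = rcons w c.
    by apply: word_surj; rewrite size_rcons; lia.
  have xA : ~~ WW cs x by apply/negP => /offA; rewrite ex prefix_refl.
  have := @resolvable_split K _ x _ _ (UU (c :: cs)) _ _ (WW (c :: cs)) _ _
    RA RB xA.
  rewrite exprS -mulrA {3}/branch.
  set PA := branch _ ^+ _ * P => split_R.
  have -> : (t2 + wseq k h + t2 * x2 * wseq k h) * PA =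
    t2 * PA + (1 + t2 * x2) * (wseq k h * PA) by ring.
  apply: split_R.
  - by rewrite negb_or xA /below ex eqxx andbF.
  - by move=> u /andP[].
  - by move=> u; rewrite /UU /= -ex hitE -andbA andb_orl.
  - move=> m /andP[/cut_below_supp[y yb ny] _]; exists y => //.
    by apply/negP => /offA; case/andP: yb => ->.
  - move=> y; rewrite /WW /= /below; rewrite -ex (inj_eq word_inj).
    case: eqP => [->|_] /=; first by rewrite prefix_refl orbT.
    by rewrite andbT; case: (W y); case: (prefix _ _); case: (has _ _).
apply: resolvable_widen (main (enum 'I_k) (enum_uniq _)).
- move=> u /=; rewrite /UU; congr (_ && _).
  apply/forallP/allP => h1 c; first by move=> _; apply: h1.
  by apply: h1; rewrite mem_enum.
- move=> y; rewrite /WW => /orP[->//|/hasP[c _ /prefix_rcons_below ->]].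
  by rewrite orbT.
by rewrite size_enum_ord.
Qed.

Lemma resolvable_tree :
  resolvable K (cut_below n [::]) (fun y => below [::] (word y)) (wseq k n).
Proof.
have := @resolvable_cut_below n [::] xpredT pred0 1 (add0n n) (resolvable_unit _ _).
move=> /(_ (fun _ => ltac:(by [])))
; apply: resolvable_widen => // [u|]; by rewrite ?andbT ?mulr1.
Qed.

Lemma cut_belowP h w u :
  cut_below h w u <->
  forall s : seq 'I_k, size s = h -> exists2 m, (m < h)%N & hit (w ++ take m.+1 s) u.
Proof.
elim: h w => [|h IH] w /=.
  by split=> // /(_ [::] erefl) [].
split=> [/forallP hc [//|c s] /= [sz]|hs].
  have /orP[hh|/IH /(_ s sz)[m hm hh]] := hc c.
    by exists 0%N => //; rewrite take0 cats1.
  by exists m.+1 => //; rewrite -cat_rcons.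
apply/forallP => c; case: (boolP (hit _ _)) => //= nh.
apply/IH => s sz; have [|m hm] := hs (c :: s); first by rewrite /= sz.
case: m hm => [|m] hm /=; first by rewrite take0 cats1 (negPf nh).
by exists m => //; rewrite cat_rcons.
Qed.

Lemma path_primeP (l : leaf k n) (p : {mpoly K[d]}) :
  path_prime (K := K) l p <->
  {in msupp p, forall u : mon, exists2 e, e \in path_edges l & (0 < u (enum_rank e))%N}.
Proof.
split=> [[c ->] u|hp].
  move=> /msupp_sum_le /flattenP[s /mapP[e]].
  rewrite mem_filter => /andP[el _] -> hu; exists e => //.
  move: hu; rewrite (perm_mem (msuppMX _ _)) => /mapP[v _ ->].
  by rewrite mnmDE mnm1E eqxx.
(* Each monomial of p is attributed to one edge of the path that divides it. *)
pose pk (u : mon) := [pick e in path_edges l | (0 < u (enum_rank e))%N].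
exists (fun e => \sum_(u <- msupp p | pk u == Some e)
  p@_u *: 'X_[u - U_(enum_rank e)]).
under eq_bigr do rewrite mulr_suml.
rewrite (exchange_big_dep xpredT) //= [LHS]mpolyE [LHS]big_seq [RHS]big_seq.
apply: eq_bigr => u hu.
case epk: (pk u) => [e|]; last first.
  move: epk; rewrite /pk; case: pickP => // h _; have [e el pe] := hp u hu.
  by have := h e; rewrite el pe.
have [el pe] : e \in path_edges l /\ (0 < u (enum_rank e))%N.
  by move: epk; rewrite /pk; case: pickP => // e' /andP[? ?] [<-].
rewrite (big_pred1 e) => [|e']; last first.
  rewrite /= eq_sym; apply/andP/eqP => [[_ /eqP[]] //|->]; by rewrite el eqxx.
rewrite -scalerAl /edge_var -mpolyXD; congr (_ *: 'X_[_]).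
apply/mnmP => y; rewrite mnmDE mnmBE mnm1E.
by case: eqP => [<-|_]; [rewrite subnK|rewrite subn0 addn0].
Qed.

Lemma cut_idealE :
  (@cut_ideal K k n : {mpoly K[d]} -> Prop) = mon_ideal (cut_below n [::]).
Proof.
apply/funext => p; apply/propext; split=> hp.
  move=> u hu; apply/cut_belowP => s /eqP sz.
  have /path_primeP/(_ u hu)[e] := hp (Tuple sz).
  rewrite inE => /eqP et pe; exists (tag e); first exact: ltn_ord.
  apply/existsP; exists (enum_rank e); rewrite pe andbT.
  by rewrite /word enum_rankK et.
move=> l; apply/path_primeP => u /hp /cut_belowP/(_ l (size_tuple l))[m hm].
case/existsP => y /andP[/eqP yw pu]; exists (enum_val y).
  rewrite inE; have em : (tag (enum_val y) : nat) = m.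
    move: (congr1 size yw); rewrite /word size_tuple /= size_takel ?size_tuple //.
    by case.
  by apply/eqP; rewrite -[LHS]/(word y) yw em.
by rewrite enum_valK.
Qed.

Lemma cut_below_upclosed h w : upclosed (cut_below h w).
Proof.
elim: h w => //= h IH w u v /forallP hu; apply/forallP => c.
have /orP[/existsP[y /andP[yw pu]]|/(IH _ _ v) ->] := hu c; last by rewrite orbT.
apply/orP; left; apply/existsP; exists y; by rewrite yw mnmDE addn_gt0 pu.
Qed.

Lemma cut_below0 h w : cut_below h w 0%MM = false.
Proof.
apply/negP => /cut_below_supp[y _]; by rewrite mnm0E.
Qed.

End Tree.

(** * Betti numbers of the cut ideal *)

Section BettiOfResolution.
Variables (K : fieldType) (d : nat).
Notation S := {mpoly K[d]}.
Notation mon := 'X_{1..d}.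
Variables (U : pred mon) (C : chain K d mon) (ep : 'cV[S]_(crk C 0)).
Hypotheses (R : minimal_resolution U ep) (upU : upclosed U) (U0 : ~~ U 0%MM).

(** Prepending S turns a resolution of the ideal into one of the quotient, which
    shifts homological degrees by one. *)
Definition quotient_rk (i : nat) : nat := if i is i'.+1 then crk C i' else 1.

Definition quotient_resolution : free_complex K d :=
  @FreeComplex K d quotient_rk
    (fun i => match i return 'I_(quotient_rk i) -> nat with
              | 0 => fun _ => 0%N
              | i'.+1 => fun a => mdeg (cdeg C i' 0 a)
              end)
    (fun i => match i return 'M[S]_(quotient_rk i.+1, quotient_rk i) with
              | 0 => ep
              | i'.+1 => cdiff C i'
              end)
    1%:M.

Lemma quotient_resolutionP :
  graded_free_resolution (mon_ideal U) quotient_resolution.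
Proof.
split.
- move=> [|i] a b u /=.
    move=> /(mr_aug R) <-; rewrite (ord1 b) mxE /mon_act.
    by rewrite addm0 addn0.
  by move=> /(mr_graded R) <-; rewrite /mon_act mdegD.
- move=> b u /=; rewrite (ord1 b) mxE eqxx msupp1 inE => /eqP ->.
  by rewrite mdeg0.
- move=> p; exists p%:M; rewrite mulmx1 mxE eqxx subrr; exact: mon_ideal0.
- move=> v /=; rewrite mulmx1; split=> [/(mr_image R)[w ew]|[w ->]].
    by exists w; apply/matrixP => i j; rewrite !ord1 ew.
  by apply/(mr_image R); exists w.
case=> [|i] v /=; first exact: (mr_exact0 R).
exact: (mr_acyclic R).
Qed.

Lemma diffK_quotient i : diffK quotient_resolution i = 0.
Proof.
case: i => [|i]; last exact: (mr_min R).
apply/matrixP => a b; rewrite !mxE; apply: memN_msupp_eq0.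
apply: contra U0 => /(mr_aug R); rewrite mon_act0 mxE => ->.
exact: (mr_deg R).
Qed.

Lemma rank_diag_bool n (b : 'I_n -> bool) :
  \rank (diag_mx (\row_a (b a)%:R) : 'M[K]_n) = (\sum_a b a)%N.
Proof.
elim: n b => [|n IH] b; first by rewrite big_ord0 [diag_mx _]flatmx0 mxrank0.
have e : diag_mx (\row_a (b a)%:R) =
    diag_mx (row_mx (\row_(a < 1) (b ord0)%:R)
                    (\row_(a < n) (b (lift ord0 a))%:R)) :> 'M[K]_(1 + n).
  congr diag_mx; apply/rowP => a; case: (splitP (a : 'I_(1 + n))) => c ec.
    have -> : a = lshift n c by apply: val_inj.
    by rewrite row_mxEl (ord1 c) !mxE; congr ((b _)%:R); apply: val_inj.
  have -> : a = rshift 1 c by apply: val_inj.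
  by rewrite row_mxEr !mxE; congr ((b _)%:R); apply: val_inj.
apply: etrans (congr1 (@mxrank K (1 + n) (1 + n)) e) _.
rewrite diag_mx_row rank_diag_block_mx IH big_ord_recl; congr addn.
rewrite rank_rV; congr nat_of_bool; case eb: (b ord0).
  by apply/eqP => /matrixP/(_ 0 0)/eqP; rewrite !mxE eqxx mulr1n oner_eq0.
by apply/negbTE; rewrite negbK; apply/eqP/matrixP => i j; rewrite !mxE mul0rn.
Qed.

Lemma betti_of_resolution i j :
  (betti (@mon_ideal K d U) i.+1 j)%:Z = gen_series C i j.
Proof.
rewrite (betti_eq upU i.+1 j quotient_resolutionP) /tor_dim /boundaries /=.
rewrite !diffK_quotient mulmx0 mxrank0 subn0.
have cap0 m p (A : 'M[K]_m) :
    \rank (A :&: kermx (0 : 'M_(m, p)))%MS = \rank A.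
  by apply: eqmx_rank; rewrite capmxSl sub_capmx submx_refl sub_kermx mulmx0 eqxx.
rewrite cap0 rank_diag_bool /gen_series /degcount.
by rewrite -natz natr_sum.
Qed.

Lemma betti_of_resolution0 : betti (@mon_ideal K d U) 0 0 = 1%N.
Proof.
rewrite (betti_eq upU 0 0 quotient_resolutionP) /tor_dim /boundaries /=.
by rewrite !diffK_quotient mulmx0 mxrank0 subn0 rank_diag_bool big_ord1.
Qed.

Lemma gen_series_finite i : exists J, forall j, (J <= j)%N -> gen_series C i j = 0.
Proof.
exists (\sum_a mdeg (cdeg C i 0%R a)).+1 => j hj.
apply: big1 => a _; case: eqP => // e.
have le : (mdeg (cdeg C i 0%R a) <= \sum_a mdeg (cdeg C i 0%R a))%N.
  by rewrite (bigD1 a) //= leq_addr.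
by have := leq_ltn_trans le hj; rewrite e ltnn.
Qed.

End BettiOfResolution.

Section TreeBetti.
Variables (K : fieldType) (k : nat).
Hypothesis hk : (2 <= k)%N.

Lemma betti_tree n i j :
  (betti (@cut_ideal K k n) i.+1 j)%:Z = wseq k n i j.
Proof.
rewrite cut_idealE; have [_ [C [ep [R _ <-]]]] := resolvable_tree K n hk.
apply: betti_of_resolution R _ _ _ _; first exact: cut_below_upclosed.
by rewrite cut_below0.
Qed.

Lemma betti_tree0 n : betti (@cut_ideal K k n) 0 0 = 1%N.
Proof.
rewrite cut_idealE; have [_ [C [ep [R _ _]]]] := resolvable_tree K n hk.
apply: betti_of_resolution0 R _ _; first exact: cut_below_upclosed.
by rewrite cut_below0.
Qed.

Lemma wseq_finite n i : exists J, forall j, (J <= j)%N -> wseq k n i j = 0.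
Proof.
have [_ [C [_ [_ _ <-]]]] := resolvable_tree K n hk.
exact: gen_series_finite.
Qed.

Lemma disagree_ex n i :
  exists j, (betti (@cut_ideal K k n) i j)%:Z != betti_limit k i j.
Proof.
case: i => [|i].
  by exists 0%N; rewrite betti_tree0 (betti_limitE hk) x2M_0.
have [J hJ] := wseq_finite n i; have [j hj pj] := wlim_unbounded hk i J.
exists j; rewrite betti_tree (betti_limitE hk) x2M_S hJ //.
by rewrite eq_sym gt_eqF.
Qed.

(** The coefficients of w_n are squeezed between those of w_m and of the limit. *)
Lemma agree_below_mono m n i M : (m <= n)%N ->
  agree_below K k m i M -> agree_below K k n i M.
Proof.
move=> mn h j jM; case: i h => [|i] h.
  have := h 0%N (leq_ltn_trans (leq0n j) jM).
  by rewrite betti_tree0 (betti_limitE hk) x2M_0.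
have := h j jM; rewrite !betti_tree (betti_limitE hk) x2M_S => e.
apply/le_anti; rewrite wseq_le_wlim //= -e.
exact: wseq_mono.
Qed.

End TreeBetti.

Theorem theorem4p7 (K : fieldType) (R : realType) (k : nat) (q : R)
    (hk : (2 <= k)%N) (hq : 0 <= q <= qstar R k) :
  exists N : nat -> nat -> nat,
    (forall n i : nat,
      agree_below K k n i (N n i) /\
      (forall M : nat, agree_below K k n i M -> (M <= N n i)%N)) /\
    (forall i m n : nat, (m <= n)%N -> (N m i <= N n i)%N).
Proof.
pose N n i := ex_minn (disagree_ex K hk n i).
have NP n i : agree_below K k n i (N n i) /\
    (forall M : nat, agree_below K k n i M -> (M <= N n i)%N).
  rewrite /N; case: ex_minnP => m hm min; split=> [j jm|M hM].
    by apply/eqP; apply: contraTT jm => /min; rewrite -leqNgt.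
  rewrite leqNgt; apply: contra hm => /hM ->; exact: eqxx.
exists N; split=> // i m n mn; have [_ maxN] := NP n i.
by apply: maxN; apply: agree_below_mono (proj1 (NP m i)).
Qed.
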